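(* Let $\boldsymbol S=(S_1,\ldots,S_d)$ be the $d$-tuple of multiplication operators by the coordinate functions on the Hardy space $H^2(\mathbb B_d)$. Then the operator $\mathrm{dEt}\big([\![\boldsymbol S^*,\boldsymbol S]\!]\big)$ is non-negative definite and $\mathrm{trace}\,\big(\mathrm{dEt}\big([\![\boldsymbol S^*,\boldsymbol S]\!]\big)\big)=1$.
   Context: $\mathbb B_d=\{\boldsymbol z\in\mathbb C^d:|z_1|^2+\cdots+|z_d|^2<1\}$. The Hardy space $H^2(\mathbb B_d)$ is the Hilbert space of holomorphic functions on $\mathbb B_d$ with reproducing kernel $(1-\langle\boldsymbol z,\boldsymbol w\rangle)^{-d}$; it has orthonormal basis $e_{\boldsymbol\alpha}(\boldsymbol z)=\sqrt{(d)_{|\boldsymbol\alpha|}/\boldsymbol\alpha!}\;z_1^{\alpha_1}\cdots z_d^{\alpha_d}$, $\boldsymbol\alpha\in\mathbb N_0^d$, where $(d)_n=d(d+1)\cdots(d+n-1)$, $|\boldsymbol\alpha|=\alpha_1+\cdots+\alpha_d$ and $\boldsymbol\alpha!=\alpha_1!\cdots\alpha_d!$. Thus $S_ie_{\boldsymbol\alpha}=\sqrt{(\alpha_i+1)/(|\boldsymbol\alpha|+d)}\;e_{\boldsymbol\alpha+\epsilon_i}$, where $\epsilon_i$ is the $i$-th standard unit multi-index. For a commuting $d$-tuple $\boldsymbol T$ of bounded operators, $[\![\boldsymbol T^*,\boldsymbol T]\!]$ is the $d\times d$ block operator with $(i,j)$ entry $B_{ij}=[T_j^*,T_i]=T_j^*T_i-T_iT_j^*$,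 and $$\mathrm{dEt}\big([\![\boldsymbol T^*,\boldsymbol T]\!]\big):=\sum_{\sigma,\tau\in\mathfrak S_d}\mathrm{Sgn}(\sigma)\,B_{\tau(1),\sigma(\tau(1))}B_{\tau(2),\sigma(\tau(2))}\cdots B_{\tau(d),\sigma(\tau(d))},$$ where $\mathfrak S_d$ is the permutation group on $d$ symbols. *)

(* Defs.v *)
From HB Require Import structures.
From mathcomp Require Import all_boot all_order all_algebra perm.
From mathcomp Require Import all_classical all_reals all_analysis.
From mathcomp Require Import complex.

Set Implicit Arguments.
Unset Strict Implicit.
Unset Printing Implicit Defensive.

Import Order.TTheory GRing.Theory Num.Theory.
Import numFieldNormedType.Exports.

Local Open Scope classical_set_scope.
Local Open Scope ring_scope.

(* A complex Hilbert space is a complete normed space H over R[i] together with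
   an inner product ip (linear in its first argument) inducing its norm. *)
Section HilbertSpace.
Context {R : realType} {H : completeNormedModType R[i]}.
Variable ip : {dot H for Num.conj}.

Definition hilbert_ip : Prop := forall f : H, ip f f = `|f| ^+ 2.

Definition bounded_operator (T : H -> H) : Prop :=
  linear T /\ exists M : R[i], forall f : H, `|T f| <= M * `|f|.

(* T^* g is the unique h with <T f, g> = <f, h> for all f; it exists by the
   Riesz representation theorem when T is bounded. *)
Definition adjoint (T : H -> H) (g : H) : H :=
  xget 0 [set h | forall f : H, ip (T f) g = ip f h].

(* In R[i], 0 <= z means that z is real and nonnegative. *)
Definition nonneg_definite (T : H -> H) : Prop := forall f : H, 0 <= ip (T f) f.

Definition orthonormal_basis (E : set H) : Prop :=
  [/\ forall e, E e -> ip e e = 1,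
      forall e e', E e -> E e' -> e != e' -> ip e e' = 0
    & forall f, (forall e, E e -> ip f e = 0) -> f = 0].

(* Unconditional summation: convergence along the finite subsets of E. *)
Definition has_sum (E : set H) (a : H -> R[i]) (s : R[i]) : Prop :=
  forall eps : R[i], 0 < eps -> exists2 F0 : set H,
    finite_set F0 /\ F0 `<=` E &
    forall F : set H, finite_set F -> F0 `<=` F -> F `<=` E ->
      `|\sum_(e \in F) a e - s| < eps.

(* P is the positive square root of T^* T. *)
Definition is_absolute_value (T P : H -> H) : Prop :=
  [/\ bounded_operator P, nonneg_definite P & P \o P = adjoint T \o T].

Definition trace_class (T : H -> H) : Prop :=
  bounded_operator T /\
  exists P, is_absolute_value T P /\
    exists2 E, orthonormal_basis E &
      exists s, has_sum E (fun e => ip (P e) e) s.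

Definition has_trace (T : H -> H) (t : R[i]) : Prop :=
  trace_class T /\
  forall E, orthonormal_basis E -> has_sum E (fun e => ip (T e) e) t.

(* The (i, j) entry [T_j^*, T_i] of the block operator [[T^*, T]]. *)
Definition commutator_block (d : nat) (T : 'I_d -> H -> H) (i j : 'I_d) :
  H -> H := fun f => adjoint (T j) (T i f) - T i (adjoint (T j) f).

(* The products of operators are compositions, in the order
   B_(t 0)(s (t 0)) \o ... \o B_(t (d - 1))(s (t (d - 1))). *)
Definition dEt (d : nat) (B : 'I_d -> 'I_d -> H -> H) : H -> H := fun f =>
  \sum_(s : 'S_d) \sum_(t : 'S_d)
    (-1) ^+ s *: (\big[comp/idfun]_(i < d) B (t i) (s (t i))) f.

End HilbertSpace.

Section HardySpace.
Context {R : realType} {d : nat}.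

Definition cdot (z w : 'rV[R[i]]_d) : R[i] := \sum_(i < d) z 0 i * (w 0 i)^*.

Definition unit_ball : set 'rV[R[i]]_d :=
  [set z | \sum_(i < d) `|z 0 i| ^+ 2 < 1].

Definition hardy_kernel (z w : 'rV[R[i]]_d) : R[i] := (1 - cdot z w) ^- d.

Section FunctionSpace.
Context {H : completeNormedModType R[i]}.
Variables (ip : {dot H for Num.conj}) (ev : H -> 'rV[R[i]]_d -> R[i]^o).

(* H is a Hilbert space of functions on D: ev f z is the value at z of the
   element f of H, only the values at points of D being meaningful. *)
Record is_rkhs (D : set 'rV[R[i]]_d) (K : 'rV[R[i]]_d -> 'rV[R[i]]_d -> R[i]) :
    Prop := IsRKHS {
  rkhs_hilbert : hilbert_ip ip;
  rkhs_linear : forall z, D z -> forall (a : R[i]) (f g : H),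
    ev (a *: f + g) z = a * ev f z + ev g z;
  rkhs_inj : forall f g : H, (forall z, D z -> ev f z = ev g z) -> f = g;
  rkhs_reproducing : forall w, D w -> exists k : H,
    (forall z, D z -> ev k z = K z w) /\ (forall f : H, ev f w = ip f k)
}.

(* Since the ball is open, differentiability over R[i] at each of its points is
   holomorphy on the ball. *)
Definition is_hardy_space : Prop :=
  is_rkhs unit_ball hardy_kernel /\
  forall (f : H) (z : 'rV[R[i]^o]_d), unit_ball z -> differentiable (ev f) z.

(* The element of H whose values on the ball are z_i * f z: unique by rkhs_inj,
   and it exists when H is the Hardy space. *)
Definition coordinate_mult (i : 'I_d) (f : H) : H :=
  xget 0 [set h | forall z, unit_ball z -> ev h z = z 0 i * ev f z].

End FunctionSpace.
End HardySpace.

(* Main.v *)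
Require Import Defs.
From HB Require Import structures.
From mathcomp Require Import all_boot all_order all_algebra perm finmap.
From mathcomp Require Import all_classical all_reals all_analysis summability.
From mathcomp Require Import complex ring lra.

(** The monomials z^al form an orthogonal total family of the Hardy space, of
    squared norms al! / (d)_|al| ([monomial_sqnorm], [mono_orth], [mono_total]).
    On them S_i raises the i-th exponent, and S_j^* lowers the j-th one with the
    factor al_j / (|al| + d - 1). Hence on homogeneous polynomials of degree n the
    commutator of S_j^* and S_i is a times the Kronecker symbol minus
    b z_i d/dz_j, where a = 1 / (n + d) and a + b = 1 / (n + d - 1)
    ([commutator_mono]).

    The determinant of such a matrix, for a fixed ordering of the rows, is computed
    one row at a time: products of two derivatives cancel by antisymmetry in the
    columns, so at most one derivative survives, and it only contributes a factor
    a + b each time it passes a later row ([row_product_derivative],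
    [sum_row_product]). Summing over all orderings, dEt acts on degree n as the
    scalar ([dEt_mono])

      c_n = (d - 1)! ((n + d) / (n + d)^d - n / (n + d - 1)^d).

    Bernoulli's inequality gives c_n >= 0. There are 'C(n + d - 1, d - 1) monomials
    of degree n, and the sum of c_n over all monomials telescopes: the part of
    degree less than N is N (N + 1) ... (N + d - 1) / (N + d - 1)^d, which tends
    to 1 ([partial_traceS], [partial_trace_gt]). So dEt is diagonal on an orthogonal
    total family with nonnegative eigenvalues of sum 1. It is therefore nonnegative,
    and its diagonal sum is 1 in every orthonormal basis ([diagonal_nonneg],
    [diagonal_has_trace]).

    The space H is known only through its reproducing kernel, so the monomials have
    to be found in it. The coordinates of the point w of the kernel
    (1 - <z, w>)^(-d) are treated one at a time. As a function of the conjugate of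
    one coordinate of w, the kernel is a power series with values in H; its
    coefficients are limits of difference quotients, which converge because their
    Gram matrices are Taylor tails of negative powers ([cauchy_dnbhs0],
    [tail_ok_all]). Orthogonality, norms and totality pass from the kernels to the
    coefficients ([stageS]), and after d steps the coefficients are the
    monomials. *)

Set Implicit Arguments.
Unset Strict Implicit.
Unset Printing Implicit Defensive.

Import Order.TTheory GRing.Theory Num.Theory.
Import numFieldNormedType.Exports.

Local Open Scope classical_set_scope.
Local Open Scope ring_scope.

#[local] Existing Instance totally_filter.

(** * Scalars and Hilbert spaces *)

Lemma fsum_split (I : choiceType) (V : nmodType) (F : I -> V) (X Y : {fset I}) :
  (X `<=` Y)%fset ->
  \sum_(i <- Y) F i = \sum_(i <- X) F i + \sum_(i <- (Y `\` X)%fset) F i.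
Proof.
move=> XY; rewrite -big_cat; apply: perm_big; apply: uniq_perm.
- exact: fset_uniq.
- rewrite cat_uniq !fset_uniq /= andbT; apply/hasPn => i.
  by rewrite in_fsetD => /andP[].
- move=> i; rewrite mem_cat in_fsetD.
  by have /fsubsetP/(_ i) := XY; case: (i \in X) => //= ->.
Qed.

Lemma cvg_bigsum (R : realType) (J T : Type) (F : set_system T) {FF : Filter F}
    (s : seq J) (f : J -> T -> R) (l : J -> R) :
  (forall j, f j @ F --> l j) ->
  (fun x => \sum_(j <- s) f j x) @ F --> \sum_(j <- s) l j.
Proof.
move=> fl; elim: s => [|j s IH].
  by rewrite big_nil; under eq_fun do rewrite big_nil; exact: cvg_cst.
rewrite big_cons; under eq_fun do rewrite big_cons.
by apply: cvgD => //; exact: fl.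
Qed.

Section Scalars.
Variable R : realType.
Local Notation C := (R[i]^o).
Implicit Types z : R[i].

(** The order of [R[i]] is only partial, so squared moduli, and squared norms
    below, are taken in [R], where suprema and epsilon arguments live. *)
Definition csq z : R := complex.Re z ^+ 2 + complex.Im z ^+ 2.

Lemma csqE z : (csq z)%:C%C = z * z^*.
Proof. by rewrite /csq add_Re2_Im2 normCK. Qed.

Lemma csq_ge0 z : 0 <= csq z.
Proof. by rewrite addr_ge0 ?sqr_ge0. Qed.

Lemma csqM z1 z2 : csq (z1 * z2) = csq z1 * csq z2.
Proof.
by apply: complexI; rewrite rmorphM /= !csqE rmorphM mulrACA.
Qed.

Lemma csqV z : csq z^-1 = (csq z)^-1.
Proof. by apply: complexI; rewrite fmorphV /= !csqE fmorphV invfM. Qed.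

Lemma csq_real (x : R) : csq x%:C%C = x ^+ 2.
Proof. by rewrite /csq /= expr0n addr0. Qed.

Lemma csq_eq0 z : (csq z == 0) = (z == 0).
Proof.
by rewrite -(inj_eq (@complexI R)) /= csqE rmorph0 mulf_eq0 conjC_eq0 orbb.
Qed.

Lemma conjC_real (x : R) : (x%:C%C)^* = x%:C%C.
Proof. by apply: conj_Creal; rewrite complex_real. Qed.

Lemma gt0_complexP z : 0 < z -> exists2 x : R, 0 < x & z = x%:C%C.
Proof.
rewrite ltcE /= => /andP[/eqP h z0]; exists (complex.Re z) => //.
by apply/eqP; rewrite eq_complex /= h !eqxx.
Qed.

Lemma real_complex_cvg T (F : set_system T) {FF : Filter F} (f : T -> R) (l : R) :
  ((f x)%:C%C : C) @[x --> F] --> (l%:C%C : C) <-> f x @[x --> F] --> l.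
Proof.
split=> /cvgrPdist_lt h; apply/cvgrPdist_lt => e e0.
  have /h : (0 : C) < e%:C%C by rewrite ltcR.
  apply: filterS => x; rewrite -rmorphB.
  by rewrite normc_def /= expr0n addr0 sqrtr_sqr ltcR.
have [r /h r0 ->] := gt0_complexP e0.
apply: filterS r0 => x; rewrite -rmorphB => hx.
by rewrite normc_def /= expr0n addr0 sqrtr_sqr ltcR.
Qed.

Lemma cvgC_unique T (F : set_system T) {FF : ProperFilter F} (f : T -> C)
    (a b : R[i]) : f @ F --> (a : C) -> f @ F --> (b : C) -> a = b.
Proof. by move=> fa fb; apply: (cvg_unique _ fa fb); exact: norm_hausdorff. Qed.

End Scalars.

Section Hilbert.
Variables (R : realType) (H : completeNormedModType R[i]).
Local Notation C := (R[i]^o).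
Variable ip : {dot H for Num.conj}.
Hypothesis hip : hilbert_ip ip.

Definition sqnorm (f : H) : R := complex.Re (ip f f).
Local Notation nsq := sqnorm.

Lemma ip_nsq f : ip f f = (nsq f)%:C%C.
Proof.
have := dnorm_ge0 ip f; rewrite lecE /= => /andP[/eqP h _].
by apply/eqP; rewrite eq_complex /= h !eqxx.
Qed.

Lemma nsq_ge0 f : 0 <= nsq f.
Proof. by rewrite -lecR -ip_nsq dnorm_ge0. Qed.

Lemma nsq_eq0 f : (nsq f == 0) = (f == 0).
Proof. by rewrite -(inj_eq (@complexI R)) /= -ip_nsq dnorm_eq0. Qed.

Lemma nsq_norm f : `|f| ^+ 2 = (nsq f)%:C%C.
Proof. by rewrite -hip ip_nsq. Qed.

Lemma ipC f g : ip f g = (ip g f)^*.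
Proof. by rewrite hermC expr0 mul1r. Qed.

Lemma csq_ipC f g : csq (ip f g) = csq (ip g f).
Proof. by apply: complexI; rewrite !csqE mulrC [ip f g]ipC conjCK. Qed.

Lemma ipZl a f g : ip (a *: f) g = a * ip f g.
Proof. by rewrite linearZl_LR. Qed.

Lemma ipZr a f g : ip f (a *: g) = a^* * ip f g.
Proof. by rewrite linearZr_LR. Qed.

Lemma ipBl f g h : ip (f - g) h = ip f h - ip g h.
Proof. by rewrite linearBl. Qed.

Lemma ipBr f g h : ip f (g - h) = ip f g - ip f h.
Proof. by rewrite linearBr. Qed.

Lemma ipDl f g h : ip (f + g) h = ip f h + ip g h.
Proof. by rewrite linearDl. Qed.

Lemma ipDr f g h : ip f (g + h) = ip f g + ip f h.
Proof. by rewrite linearDr. Qed.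

Lemma ip0l g : ip 0 g = 0.
Proof. by rewrite linear0l. Qed.

Lemma ip0r g : ip g 0 = 0.
Proof. by rewrite linear0r. Qed.

Lemma ip_suml (J : Type) (s : seq J) (F : J -> H) g :
  ip (\sum_(j <- s) F j) g = \sum_(j <- s) ip (F j) g.
Proof. by elim/big_rec2: _ => [|j y x _ <-]; rewrite ?ip0l ?ipDl. Qed.

Lemma ip_sumr (J : Type) (s : seq J) (F : J -> H) g :
  ip g (\sum_(j <- s) F j) = \sum_(j <- s) ip g (F j).
Proof. by elim/big_rec2: _ => [|j y x _ <-]; rewrite ?ip0r ?ipDr. Qed.

Lemma nsqZ a f : nsq (a *: f) = csq a * nsq f.
Proof.
by apply: complexI; rewrite rmorphM /= -!ip_nsq csqE ipZl ipZr mulrA.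
Qed.

Lemma nsqN f : nsq (- f) = nsq f.
Proof. by rewrite /sqnorm hnormN. Qed.

Lemma nsq_parallelogram f g :
  nsq (f + g) + nsq (f - g) = 2 * nsq f + 2 * nsq g.
Proof.
apply: complexI; rewrite !rmorphD !rmorphM /= -!ip_nsq rmorph_nat.
by rewrite !ipBl !ipBr !ipDl !ipDr; ring.
Qed.

Lemma nsqD_le f g : nsq (f + g) <= 2 * nsq f + 2 * nsq g.
Proof. by rewrite -nsq_parallelogram lerDl nsq_ge0. Qed.

Lemma nsqB_le f g : nsq (f - g) <= 2 * nsq f + 2 * nsq g.
Proof. by rewrite -nsq_parallelogram lerDr nsq_ge0. Qed.

Lemma CauchySchwarz_nsq f g : csq (ip f g) <= nsq f * nsq g.
Proof.
have [->|g0] := eqVneq g 0.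
  by rewrite ip0r /csq expr0n addr0 /sqnorm ip0r mulr0.
have gp : 0 < nsq g by rewrite lt0r nsq_eq0 g0 nsq_ge0.
have := nsq_ge0 (f - (ip f g / ip g g) *: g).
have -> : nsq (f - (ip f g / ip g g) *: g) = nsq f - csq (ip f g) / nsq g.
  apply: complexI; rewrite rmorphB rmorphM fmorphV /= -ip_nsq csqE.
  rewrite !(ipBl, ipBr, ipZl, ipZr) [ip g f]ipC.
  rewrite rmorphM fmorphV /= (ip_nsq g) conjC_real (ip_nsq f).
  have gC : (nsq g)%:C%C != 0 :> R[i] by rewrite fmorph_eq0 gt_eqF.
  by move: (ip f g) ((ip f g)^*) => x y; field.
by rewrite subr_ge0 ler_pdivrMr.
Qed.

Lemma cvg_nsqP T (F : set_system T) {FF : Filter F} (u : T -> H) (l : H) :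
  u @ F --> l <-> forall e : R, 0 < e -> \forall x \near F, nsq (l - u x) < e.
Proof.
split=> [/cvgrPdist_lt h e e0|h]; last first.
  apply/cvgrPdist_lt => e e0.
  have [r r0 eE] := gt0_complexP e0.
  have /h : 0 < r ^+ 2 by rewrite exprn_gt0.
  apply: filterS => x hx.
  rewrite -(@ltr_pXn2r _ 2) ?nnegrE ?(ltW e0) // nsq_norm eE -rmorphXn.
  by rewrite ltcR.
have e1 : (0 : R[i]) < (Num.sqrt e)%:C%C by rewrite ltcR sqrtr_gt0.
have := h _ e1; apply: filterS => x.
rewrite -(@ltr_pXn2r _ 2) ?nnegrE ?(ltW e1) // nsq_norm -rmorphXn /=.
by rewrite sqr_sqrtr ?(ltW e0) // ltcR.
Qed.

(** Completeness of H, in the form used for nets of finite sums and for limits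
    at a punctured neighbourhood alike. *)
Lemma nsq_cauchy_cvg T (F : set_system T) {FF : ProperFilter F} (u : T -> H) :
  (forall e : R, 0 < e -> exists2 A, F A &
     forall x y, A x -> A y -> nsq (u x - u y) < e) ->
  exists l : H, u @ F --> l.
Proof.
move=> h; suff /cvg_ex[l ul] : cvg (u x @[x --> F]) by exists l.
apply: (iffLR (@cauchy_cvgP H (u @ F) _)); apply: cauchy_exP => e e0.
have [r r0 eE] := gt0_complexP e0.
have /h[A FA hA] : 0 < r ^+ 2 by rewrite exprn_gt0.
have [x Ax] := filter_ex FA.
exists (u x); rewrite /=.
apply: filterS FA => y Ay.
rewrite -ball_normE /=.
rewrite -(@ltr_pXn2r _ 2) ?nnegrE ?(ltW e0) // nsq_norm eE -rmorphXn.
by rewrite ltcR; exact: hA.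
Qed.

Lemma cvgH_unique T (F : set_system T) {FF : ProperFilter F} (u : T -> H)
    (a b : H) : u @ F --> a -> u @ F --> b -> a = b.
Proof. by move=> fa fb; apply: (cvg_unique _ fa fb); exact: norm_hausdorff. Qed.

Lemma cvg_ipl T (F : set_system T) {FF : Filter F} (u : T -> H) (l g : H) :
  u @ F --> l -> (ip (u x) g : C) @[x --> F] --> (ip l g : C).
Proof.
move=> /cvg_nsqP h; apply/cvgrPdist_lt => e e0.
have [r r0 eE] := gt0_complexP e0.
have gp : 0 < nsq g + 1 by rewrite ltr_wpDl ?nsq_ge0.
have /h : 0 < r ^+ 2 / (nsq g + 1) by rewrite divr_gt0 ?exprn_gt0.
apply: filterS => x; rewrite ltr_pdivlMr // => hx.
rewrite -(@ltr_pXn2r _ 2) ?nnegrE ?(ltW e0) // -ipBl.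
rewrite normCK -csqE eE -rmorphXn ltcR.
apply: le_lt_trans (CauchySchwarz_nsq _ _) (le_lt_trans _ hx).
by rewrite ler_wpM2l ?nsq_ge0 // lerDl.
Qed.

Lemma cvg_ipr T (F : set_system T) {FF : Filter F} (u : T -> H) (l g : H) :
  u @ F --> l -> (ip g (u x) : C) @[x --> F] --> (ip g l : C).
Proof.
move=> ul; have /cvgrPdist_lt h : (ip (u x) g : C) @[x --> F] --> (ip l g : C).
  exact: cvg_ipl.
apply/cvgrPdist_lt => e /h.
by apply: filterS => x; rewrite -norm_conjC rmorphB /= -!ipC.
Qed.

Lemma cvg_nsq T (F : set_system T) {FF : Filter F} (u : T -> H) (l : H) :
  u @ F --> l -> nsq (u x) @[x --> F] --> nsq l.
Proof.
move=> ul; apply/real_complex_cvg.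
have -> : (fun x => (nsq (u x))%:C%C : C) = (fun x =>
    ip (u x) l + ip l (u x) - ip l l + (nsq (l - u x))%:C%C).
  by apply/funext => x; rewrite -!ip_nsq !ipBl !ipBr; ring.
rewrite -ip_nsq -[X in _ --> X]addr0 -[X in _ --> X + _](addrK (ip l l)).
apply: cvgD; last first.
  apply/(real_complex_cvg _ 0)/cvgrPdist_lt => e e0.
  move: ul => /cvg_nsqP/(_ _ e0); apply: filterS => x.
  by rewrite sub0r normrN ger0_norm ?nsq_ge0.
apply: cvgB; last exact: cvg_cst.
by apply: cvgD; [exact: cvg_ipl|exact: cvg_ipr].
Qed.

Lemma nsq_lim_le T (F : set_system T) {FF : ProperFilter F} (u : T -> H)
    (l : H) (b : R) :
  u @ F --> l -> (\forall x \near F, nsq (u x) <= b) -> nsq l <= b.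
Proof. by move=> ul hb; apply: cvgr_to_le hb; exact: cvg_nsq. Qed.

End Hilbert.

(** * Orthogonal expansions, weighted shifts and traces *)

(** A finite set whose sum nearly attains the supremum leaves no room outside. *)
Lemma finite_sums_cauchy (R : realType) (I : choiceType) (w : I -> R) (M : R) :
  (forall i, 0 <= w i) -> (forall X : {fset I}, \sum_(i <- X) w i <= M) ->
  forall e, 0 < e -> exists X0 : {fset I}, forall X : {fset I},
    (X0 `<=` X)%fset -> \sum_(i <- (X `\` X0)%fset) w i < e.
Proof.
move=> w0 wM e e0.
pose S := [set x | exists X : {fset I}, x = \sum_(i <- X) w i].
have hS : has_sup S.
  split; first by exists (\sum_(i <- fset0) w i), fset0.
  by exists M => x [X ->].
have [_ [X0 ->] hX0] := sup_adherent e0 hS.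
exists X0 => X X0X.
have : \sum_(i <- X) w i <= sup S by apply: ub_le_sup; [case: hS | exists X].
by rewrite (fsum_split _ X0X); lra.
Qed.

Section OrthogonalFamily.
Variables (R : realType) (H : completeNormedModType R[i]).
Local Notation C := (R[i]^o).
Variable ip : {dot H for Num.conj}.
Hypothesis hip : hilbert_ip ip.
Local Notation nsq := (sqnorm ip).

Definition bounded (T : H -> H) :=
  linear T /\ exists2 M : R, 0 <= M & forall f, nsq (T f) <= M * nsq f.

Lemma linear_at0 T : bounded T -> T 0 = 0.
Proof.
by move=> [lT _]; have := lT (-1) 0 0; rewrite !scaleN1r oppr0 addr0 addNr.
Qed.

Lemma bounded_cvg T (J : Type) (F : set_system J) {FF : Filter F}
    (u : J -> H) (l : H) :
  bounded T -> u @ F --> l -> T (u x) @[x --> F] --> T l.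
Proof.
move=> [lT [M M0 hM]] /(cvg_nsqP hip) h; apply/(cvg_nsqP hip) => e e0.
have Mp : 0 < M + 1 by rewrite ltr_wpDl.
have /h : 0 < e / (M + 1) by rewrite divr_gt0.
apply: filterS => x; rewrite ltr_pdivlMr // => hx.
have -> : T l - T (u x) = T (l - u x).
  by have := lT (-1) (u x) l; rewrite !scaleN1r addrC => <-; rewrite addrC.
apply: le_lt_trans (hM _) (le_lt_trans _ hx).
by rewrite mulrC ler_wpM2l ?nsq_ge0 // lerDl.
Qed.

Variables (I : choiceType) (m : I -> H).
Hypothesis orth : forall i j, i != j -> ip (m i) (m j) = 0.

(** The family is orthogonal, not orthonormal, and may contain zero vectors, at
    which both quotients are 0. Monomials can thus be used without normalizing
    them, and an orthonormal basis given as a set of vectors can be indexed by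
    the whole space. *)
Definition fourier f i : R[i] := ip f (m i) / ip (m i) (m i).
Definition weight f i : R := csq (ip f (m i)) / nsq (m i).

Lemma weight_ge0 f i : 0 <= weight f i.
Proof. by rewrite divr_ge0 ?csq_ge0 ?nsq_ge0. Qed.

Lemma weight_fourier f i : weight f i = csq (fourier f i) * nsq (m i).
Proof.
rewrite /weight /fourier csqM csqV ip_nsq csq_real.
have [->|n0] := eqVneq (nsq (m i)) 0; first by rewrite invr0 !mulr0.
by field.
Qed.

(** Injectivity of [p] is asked only where the coefficient is nonzero: lowering
    an exponent of a monomial is injective only on the monomials that it does
    not kill. *)
Lemma nsq_orth_sum (X : {fset I}) (a : I -> R[i]) (p : I -> I) :
  (forall i j, a i != 0 -> a j != 0 -> p i = p j -> i = j) ->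
  nsq (\sum_(i <- X) a i *: m (p i)) = \sum_(i <- X) csq (a i) * nsq (m (p i)).
Proof.
move=> pinj; apply: complexI; rewrite -ip_nsq rmorph_sum /= ip_suml.
apply: eq_big_seq => i iX; rewrite ip_sumr (big_fsetD1 i) //= big_seq big1.
  by rewrite addr0 ipZl ipZr rmorphM /= csqE ip_nsq mulrA.
move=> j; rewrite !inE => /andP[ji jX]; rewrite ipZl ipZr.
have [->|ai] := eqVneq (a i) 0; first by rewrite mul0r.
have [->|aj] := eqVneq (a j) 0; first by rewrite rmorph0 mul0r mulr0.
rewrite orth ?mulr0 //; apply: contraNneq ji => /pinj -> //.
Qed.

Lemma ip_fourier_sum (X : {fset I}) f :
  ip f (\sum_(i <- X) fourier f i *: m i) = (\sum_(i <- X) weight f i)%:C%C.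
Proof.
rewrite ip_sumr rmorph_sum; apply: eq_bigr => i _ /=.
rewrite ipZr /weight /fourier ip_nsq rmorphM rmorphM !fmorphV /= conjC_real csqE.
by rewrite mulrAC [X in X / _]mulrC.
Qed.

(** The squared distance from f to its partial expansion is nonnegative. *)
Lemma bessel (X : {fset I}) f : \sum_(i <- X) weight f i <= nsq f.
Proof.
have := nsq_ge0 ip (f - \sum_(i <- X) fourier f i *: m i).
set P := \sum_(i <- X) _; suff -> : nsq (f - P) = nsq f - \sum_(i <- X) weight f i.
  by rewrite subr_ge0.
apply: complexI; rewrite rmorphB /= -ip_nsq ipBl !ipBr [ip P f]ipC.
rewrite ip_fourier_sum conjC_real !ip_nsq.
have -> : nsq P = \sum_(i <- X) weight f i.
  rewrite /P (nsq_orth_sum X (p := id)) //; apply: eq_bigr => i _.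
  by rewrite weight_fourier.
by rewrite subrr subr0.
Qed.

Section Shift.
Variables (a : I -> R[i]) (p : I -> I) (M : R).
Hypothesis M0 : 0 <= M.
Hypothesis pinj : forall i j, a i != 0 -> a j != 0 -> p i = p j -> i = j.
Hypothesis aM : forall i, csq (a i) * nsq (m (p i)) <= M * nsq (m i).

Let term f i := (fourier f i * a i) *: m (p i).

Lemma nsq_shift_sum (X : {fset I}) f :
  nsq (\sum_(i <- X) term f i) <= M * \sum_(i <- X) weight f i.
Proof.
rewrite (nsq_orth_sum X (p := p)); last first.
  by move=> i j; rewrite !mulf_eq0 !negb_or => /andP[_ ai] /andP[_ aj]; exact: pinj.
rewrite mulr_sumr; apply: ler_sum => i _.
by rewrite csqM -mulrA weight_fourier [leRHS]mulrCA ler_wpM2l ?csq_ge0.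
Qed.

(** The tails are dominated by tails of the Bessel sums of f. *)
Lemma shift_sum_cvg f :
  exists l : H, (fun X : {fset I} => \sum_(i <- X) term f i) @ totally --> l.
Proof.
apply: (nsq_cauchy_cvg hip) => e e0.
have Mp : 0 < 4 * (M + 1) by rewrite mulr_gt0 // ltr_wpDl.
have /(finite_sums_cauchy (weight_ge0 f) (fun X => bessel X f))[X0 hX0] :
  0 < e / (4 * (M + 1)) by rewrite divr_gt0.
exists [set X | (X0 `<=` X)%fset] => [|X Y /= hX hY].
  by exists X0.
rewrite (fsum_split _ hX) (fsum_split (term f) hY) opprD addrACA subrr add0r.
apply: le_lt_trans (nsqB_le ip _ _) _.
have := nsq_shift_sum (X `\` X0)%fset f.
have := nsq_shift_sum (Y `\` X0)%fset f.
have := hX0 _ hX; have := hX0 _ hY; rewrite !ltr_pdivlMr //.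
set x := \sum_(i <- (X `\` X0)%fset) weight f i.
set y := \sum_(i <- (Y `\` X0)%fset) weight f i.
have x0 : 0 <= x by apply: sumr_ge0 => i _; exact: weight_ge0.
have y0 : 0 <= y by apply: sumr_ge0 => i _; exact: weight_ge0.
move=> h1 h2 h3 h4; nra.
Qed.

(** Every operator of the theorem (multiplication by a coordinate, its adjoint,
    the square root of dEt) maps each monomial to a multiple of a monomial; this
    lemma produces all of them as everywhere defined bounded operators. *)
Lemma weighted_shift :
  exists T : H -> H, bounded T /\ forall i, T (m i) = a i *: m (p i).
Proof.
have /choice[T hT] := shift_sum_cvg.
exists T; split; [split|].
- move=> c f g; apply: (cvgH_unique (hT _)).
  have -> : (fun X : {fset I} => \sum_(i <- X) term (c *: f + g) i) =
      (fun X : {fset I} => c *: (\sum_(i <- X) term f i) + \sum_(i <- X) term g i).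
    apply/funext => X; rewrite scaler_sumr -big_split; apply: eq_bigr => i _.
    rewrite /term /= /fourier ipDl ipZl scalerA -scalerDl.
    by rewrite [in RHS]mulrA [in RHS]mulrA -!mulrDl.
  by apply: cvgD; [apply: cvgZr|]; exact: hT.
- exists M => // f; apply: (nsq_lim_le hip (hT f)); near=> X.
  by apply: le_trans (nsq_shift_sum X f) _; rewrite ler_wpM2l ?bessel.
- move=> i; apply: (cvgH_unique (hT _)).
  apply: cvg_near_cst; exists [fset i]%fset => // X /=.
  rewrite fsub1set => iX.
  rewrite (big_fsetD1 i) //= big_seq big1 ?addr0.
    rewrite /term /fourier.
    have [n0|n0] := eqVneq (ip (m i) (m i)) 0; last by rewrite divff // mul1r.
    rewrite n0 mul0r mul0r scale0r.
    have := aM i. have -> : nsq (m i) = 0 by rewrite /sqnorm n0.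
    rewrite mulr0 -nsqZ => h; symmetry; apply/eqP.
    by rewrite -(nsq_eq0 ip) eq_le h nsq_ge0.
  move=> j; rewrite !inE => /andP[ji jX]; rewrite /term /fourier orth 1?eq_sym //.
  by rewrite !mul0r scale0r.
Unshelve. all: by end_near. Qed.

End Shift.

Hypothesis total : forall f, (forall i, ip f (m i) = 0) -> f = 0.

(** The limit of the expansion differs from f by a vector orthogonal to the
    whole family. *)
Lemma fourier_cvg f :
  (fun X : {fset I} => \sum_(i <- X) fourier f i *: m i) @ totally --> f.
Proof.
have [l hl] : exists l : H,
    (fun X : {fset I} => \sum_(i <- X) fourier f i *: m i) @ totally --> l.
  have [l hl] := @shift_sum_cvg (fun=> 1) id 1 ler01 (fun i j _ _ => id)
    (fun i => ltac:(by rewrite csq_real expr1n lexx)) f.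
  exists l; suff -> : (fun X : {fset I} => \sum_(i <- X) fourier f i *: m i) =
    (fun X : {fset I} => \sum_(i <- X) (fourier f i * 1) *: m i) by [].
  by apply/funext => X; apply: eq_bigr => i _; rewrite mulr1.
suff e : l = f by move: hl; rewrite e.
apply/eqP; rewrite -subr_eq0; apply/eqP/total => i; rewrite ipBl.
apply/eqP; rewrite subr_eq0; apply/eqP.
apply: cvgC_unique (cvg_ipl hip (g := m i) hl) _.
apply: cvg_near_cst; exists [fset i]%fset => // X /=.
rewrite fsub1set => iX; rewrite ip_suml (big_fsetD1 i) //= big_seq big1.
  rewrite addr0 ipZl /fourier; have [n0|n0] := eqVneq (ip (m i) (m i)) 0.
    move/eqP: (n0); rewrite dnorm_eq0 => /eqP ->; by rewrite !ip0r mulr0.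
  by rewrite divfK.
move=> j; rewrite !inE => /andP[ji jX]; rewrite ipZl orth //.
by rewrite mulr0.
Qed.

Lemma parseval f :
  (fun X : {fset I} => \sum_(i <- X) weight f i) @ totally --> nsq f.
Proof.
apply/real_complex_cvg; rewrite -ip_nsq.
have -> : (fun X : {fset I} => (\sum_(i <- X) weight f i)%:C%C : C) =
    (fun X : {fset I} => ip f (\sum_(i <- X) fourier f i *: m i)).
  by apply/funext => X; rewrite ip_fourier_sum.
apply: (cvg_ipr hip); exact: fourier_cvg.
Qed.

Lemma bounded_sum T (X : {fset I}) f : bounded T ->
  T (\sum_(i <- X) fourier f i *: m i) = \sum_(i <- X) fourier f i *: T (m i).
Proof.
move=> bT; have [lT _] := bT; have T0 := linear_at0 bT.
elim/big_rec2 : _ => // i y x _ <-; exact: lT.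
Qed.

Lemma bounded_eq T T' : bounded T -> bounded T' ->
  (forall i, T (m i) = T' (m i)) -> T =1 T'.
Proof.
move=> bT bT' e f.
have h U : bounded U ->
    (fun X : {fset I} => U (\sum_(i <- X) fourier f i *: m i)) @ totally --> U f.
  by move=> bU; apply: (bounded_cvg bU); exact: fourier_cvg.
apply: (cvgH_unique (h _ bT)).
have -> : (fun X : {fset I} => T (\sum_(i <- X) fourier f i *: m i)) =
    (fun X : {fset I} => T' (\sum_(i <- X) fourier f i *: m i)).
  by apply/funext => X; rewrite !bounded_sum //; apply: eq_bigr => i _; rewrite e.
exact: h.
Qed.

(** By linearity and continuity, an identity between bounded operators has to be
    tested on the family only. *)
Lemma bounded_form_eq T T' g g' : bounded T -> bounded T' ->
  (forall i, ip (T (m i)) g = ip (T' (m i)) g') ->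
  forall f, ip (T f) g = ip (T' f) g'.
Proof.
move=> bT bT' e f.
have h U k : bounded U -> (fun X : {fset I} =>
      ip (U (\sum_(i <- X) fourier f i *: m i)) k : C) @ totally -->
    (ip (U f) k : C).
  by move=> bU; apply: (cvg_ipl hip); apply: (bounded_cvg bU); exact: fourier_cvg.
apply: (cvgC_unique (h _ _ bT)).
have -> : (fun X : {fset I} =>
      ip (T (\sum_(i <- X) fourier f i *: m i)) g : C) =
    (fun X : {fset I} => ip (T' (\sum_(i <- X) fourier f i *: m i)) g').
  apply/funext => X; rewrite !bounded_sum // !ip_suml; apply: eq_bigr => j _.
  by rewrite !ipZl e.
exact: h.
Qed.

Lemma bounded_adjoint T T' : bounded T -> bounded T' ->
  (forall i j, ip (T (m i)) (m j) = ip (m i) (T' (m j))) ->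
  forall f g, ip (T f) g = ip f (T' g).
Proof.
move=> bT bT' e f g.
apply: (bounded_form_eq (T' := idfun) bT _) => [|i /=].
  by split=> //; exists 1 => // k; rewrite mul1r.
rewrite [LHS]ipC [RHS]ipC; congr (_^*).
apply: (bounded_form_eq (T := idfun) _ bT') => [|j /=].
  by split=> //; exists 1 => // k; rewrite mul1r.
by rewrite [LHS]ipC e -ipC.
Qed.

End OrthogonalFamily.

Section BoundedOperators.
Variables (R : realType) (H : completeNormedModType R[i]).
Variable ip : {dot H for Num.conj}.
Hypothesis hip : hilbert_ip ip.
Local Notation nsq := (sqnorm ip).
Local Notation bounded := (bounded ip).

Lemma bounded_ext T T' : T =1 T' -> bounded T -> bounded T'.
Proof. by move=> /funext ->. Qed.

Lemma bounded0 : bounded (fun=> 0).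
Proof.
split; first by move=> a u v; rewrite scaler0 addr0.
by exists 0 => // f; rewrite mul0r /sqnorm ip0r.
Qed.

Lemma bounded_id : bounded idfun.
Proof. by split=> //; exists 1 => // f; rewrite mul1r. Qed.

Lemma bounded_comp T T' : bounded T -> bounded T' -> bounded (T \o T').
Proof.
move=> [lT [M M0 hM]] [lT' [M' M'0 hM']]; split.
  by move=> a u v /=; rewrite lT' lT.
exists (M * M'); first exact: mulr_ge0.
by move=> f /=; apply: le_trans (hM _) _; rewrite -mulrA ler_wpM2l.
Qed.

Lemma boundedD T T' : bounded T -> bounded T' -> bounded (fun f => T f + T' f).
Proof.
move=> [lT [M M0 hM]] [lT' [M' M'0 hM']]; split.
  by move=> a u v /=; rewrite lT' lT scalerDr addrACA.
exists (2 * (M + M')); first by rewrite mulr_ge0 ?addr_ge0.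
move=> f; apply: le_trans (nsqD_le ip _ _) _.
by rewrite -mulrDr -mulrA ler_wpM2l // mulrDl lerD.
Qed.

Lemma boundedZ c T : bounded T -> bounded (fun f => c *: T f).
Proof.
move=> [lT [M M0 hM]]; split.
  by move=> a u v /=; rewrite lT scalerDr !scalerA mulrC.
exists (csq c * M); first by rewrite mulr_ge0 ?csq_ge0.
by move=> f; rewrite nsqZ -mulrA ler_wpM2l ?csq_ge0.
Qed.

Lemma boundedB T T' : bounded T -> bounded T' -> bounded (fun f => T f - T' f).
Proof.
move=> bT /(boundedZ (-1)) bT'; apply: bounded_ext (boundedD bT bT') => f.
by rewrite scaleN1r.
Qed.

Lemma bounded_bigsum (J : Type) (s : seq J) (T : J -> H -> H) :
  (forall j, bounded (T j)) -> bounded (fun f => \sum_(j <- s) T j f).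
Proof.
move=> bT; elim: s => [|j s IH].
  by apply: bounded_ext bounded0 => f; rewrite big_nil.
by apply: bounded_ext (boundedD (bT j) IH) => f; rewrite big_cons.
Qed.

Lemma bounded_bigcomp (J : Type) (s : seq J) (T : J -> H -> H) :
  (forall j, bounded (T j)) -> bounded (\big[comp/idfun]_(j <- s) T j).
Proof.
move=> bT; elim: s => [|j s IH]; first by rewrite big_nil; exact: bounded_id.
by rewrite big_cons; exact: bounded_comp.
Qed.

Lemma bounded_operatorP T : bounded T -> bounded_operator T.
Proof.
move=> [lT [M M0 hM]]; split => //; exists (Num.sqrt M)%:C%C => f.
have s0 : (0 : R[i]) <= (Num.sqrt M)%:C%C by rewrite lecR sqrtr_ge0.
rewrite -(@ler_pXn2r _ 2) ?nnegrE ?mulr_ge0 // exprMn !(nsq_norm hip).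
by rewrite -rmorphXn -rmorphM lecR sqr_sqrtr.
Qed.

Lemma adjoint_eq (T : H -> H) g h :
  (forall f, ip (T f) g = ip f h) -> adjoint ip T g = h.
Proof.
move=> hh; apply: xget_unique => // h' hh'; apply/eqP; rewrite -subr_eq0.
by rewrite -(dnorm_eq0 ip) ipBr -hh -hh' subrr.
Qed.

End BoundedOperators.

(** A bounded operator that is diagonal on an orthogonal total family, with
    nonnegative eigenvalues of sum t, is nonnegative of trace t. *)
Section Trace.
Variables (R : realType) (H : completeNormedModType R[i]).
Variable ip : {dot H for Num.conj}.
Hypothesis hip : hilbert_ip ip.
Local Notation nsq := (sqnorm ip).
Local Notation bounded := (bounded ip).
Variables (I : choiceType) (m : I -> H).
Hypothesis orth : forall i j, i != j -> ip (m i) (m j) = 0.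
Hypothesis total : forall f, (forall i, ip f (m i) = 0) -> f = 0.
Hypothesis m_neq0 : forall i, m i != 0.
Variables (T : H -> H) (c : I -> R) (t : R).
Hypothesis c_ge0 : forall i, 0 <= c i.
Hypothesis bT : bounded T.
Hypothesis TE : forall i, T (m i) = (c i)%:C%C *: m i.
Hypothesis c_le : forall X : {fset I}, \sum_(i <- X) c i <= t.
Hypothesis c_gt : forall e, 0 < e -> exists X : {fset I}, t - e < \sum_(i <- X) c i.

(** With a self-adjoint square root Q, the form of T is the squared norm of Q f;
    this gives nonnegativity, and turns diagonal sums of T into sums of squares. *)
Lemma diagonal_sqrt : exists Q : H -> H,
  [/\ bounded Q, forall f g, ip (Q f) g = ip f (Q g), forall f, T f = Q (Q f)
    & forall f i, weight ip m (Q f) i = c i * weight ip m f i].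
Proof.
have c_le1 i : c i <= t.
  by have := c_le [fset i]%fset; rewrite big_seq_fset1.
have t0 : 0 <= t by have := c_le fset0; rewrite big_seq_fset0.
have [||i|Q [bQ hQ]] := @weighted_shift _ _ _ hip _ _ orth
  (fun i => (Num.sqrt (c i))%:C%C) id t.
- exact: t0.
- by [].
- by rewrite csq_real sqr_sqrtr // ler_wpM2r ?nsq_ge0.
have aQ f g : ip (Q f) g = ip f (Q g).
  apply: (bounded_adjoint hip orth total bQ bQ) => i j.
  rewrite !hQ ipZl ipZr conjC_real.
  by have [->//|ij] := eqVneq i j; rewrite orth ?mulr0.
exists Q; split => //.
  move=> f; apply: (bounded_eq hip orth total bT (bounded_comp bQ bQ)) => i /=.
  have [lQ _] := bQ.
  have QZ a g : Q (a *: g) = a *: Q g.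
    by have := lQ a g 0; rewrite (linear_at0 bQ) !addr0.
  by rewrite TE hQ QZ hQ scalerA -rmorphM -expr2 sqr_sqrtr.
move=> f i; rewrite /weight aQ hQ ipZr conjC_real csqM csq_real sqr_sqrtr //.
by rewrite mulrA.
Qed.

(** For e in another orthonormal basis, the form of T at e is the sum over i of
    c i times the squared i-th coordinate of e. Exchanging the two sums, Bessel's
    inequality bounds every finite sum over e by t, and Parseval's identity for
    the vectors m i makes these sums come close to t. *)
Lemma diagonal_has_sum (E : set H) :
  orthonormal_basis ip E -> has_sum E (fun e => ip (T e) e) t%:C%C.
Proof.
move=> [E1 E2 E3].
have [Q [bQ aQ TQ wQ]] := diagonal_sqrt.
(* E, extended by zero to a family indexed by H. *)
pose b e : H := if e \in E then e else 0.
have b_orth e e' : e != e' -> ip (b e) (b e') = 0.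
  rewrite /b; case: ifPn => [|_ _]; last by rewrite ip0l.
  case: ifPn => [|_ _ _]; last by rewrite ip0r.
  by rewrite !inE; move=> ? ? ?; exact: E2.
have b_total f : (forall e, ip f (b e) = 0) -> f = 0.
  by move=> h; apply: E3 => e Ee; have := h e; rewrite /b mem_set.
have Q0 := linear_at0 bQ.
have TE' e : ip (T e) e = (nsq (Q e))%:C%C by rewrite TQ aQ ip_nsq.
have wE i e : c i * weight ip m (b e) i = c i / nsq (m i) * weight ip b (m i) e.
  rewrite /weight csq_ipC /b; case: ifPn => [|_].
    rewrite inE => /E1; rewrite ip_nsq => /(@complexI R) ->.
    by rewrite invr1 mulr1 mulrAC mulrA.
  by rewrite ip0r /csq expr0n addr0 !mul0r !mulr0.
have dbl (X : {fset I}) (F : {fset H}) :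
    \sum_(e <- F) \sum_(i <- X) c i * weight ip m (b e) i =
    \sum_(i <- X) c i / nsq (m i) * \sum_(e <- F) weight ip b (m i) e.
  rewrite exchange_big; apply: eq_bigr => i _; rewrite mulr_sumr.
  by apply: eq_bigr => e _; exact: wE.
have nm i : 0 < nsq (m i) by rewrite lt0r nsq_eq0 m_neq0 nsq_ge0.
have upper (F : {fset H}) : \sum_(e <- F) nsq (Q (b e)) <= t.
  have hX : (fun X : {fset I} =>
      \sum_(e <- F) \sum_(i <- X) c i * weight ip m (b e) i) @ totally -->
      \sum_(e <- F) nsq (Q (b e)).
    apply: cvg_bigsum => e.
    have -> : (fun X : {fset I} => \sum_(i <- X) c i * weight ip m (b e) i) =
        (fun X : {fset I} => \sum_(i <- X) weight ip m (Q (b e)) i).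
      by apply/funext => X; apply: eq_bigr => i _; rewrite wQ.
    exact: (parseval hip orth total).
  apply: (cvgr_to_le hX); apply: filterE => X /=; rewrite dbl.
  apply: le_trans (c_le X); apply: ler_sum => i _.
  have := bessel b_orth F (m i).
  move=> /(ler_wpM2l (divr_ge0 (c_ge0 i) (ltW (nm i)))) /le_trans; apply.
  by rewrite divfK ?gt_eqF.
move=> eps /gt0_complexP[e e0 ->].
have [X hX] := c_gt e0.
have : (fun F : {fset H} =>
    \sum_(i <- X) c i / nsq (m i) * \sum_(e <- F) weight ip b (m i) e) @ totally -->
    \sum_(i <- X) c i.
  have -> : \sum_(i <- X) c i = \sum_(i <- X) c i / nsq (m i) * nsq (m i).
    by apply: eq_bigr => i _; rewrite divfK ?gt_eqF.
  apply: cvg_bigsum => i; apply: cvgMr.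
  exact: (parseval hip b_orth b_total).
move=> /cvgr_gt/(_ _ hX)[F0 _ hF0].
exists [set x | x \in F0 /\ E x].
  split; last by move=> x [].
  by apply: sub_finite_set (finite_fset F0) => x [].
move=> F finF F0F FE; rewrite fsbig_finite //.
set Y := fset_set F.
have YE e1 : e1 \in Y -> e1 \in F by rewrite in_fset_set.
have -> : \sum_(e1 <- Y) ip (T e1) e1 = (\sum_(e1 <- Y) nsq (Q (b e1)))%:C%C.
  rewrite rmorph_sum; apply: eq_big_seq => e1 /YE; rewrite inE => /FE Ee.
  by rewrite TE' /b mem_set.
have le_t := upper Y.
have gt_te : t - e < \sum_(e1 <- Y) nsq (Q (b e1)).
  apply: (@lt_le_trans _ _ (\sum_(e1 <- (Y `|` F0)%fset) nsq (Q (b e1)))).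
    apply: lt_le_trans (hF0 (Y `|` F0)%fset _) _ => /=; first exact: fsubsetUr.
    rewrite -dbl; apply: ler_sum => e1 _.
    apply: le_trans (bessel orth X (Q (b e1))).
    by rewrite le_eqVlt; apply/orP; left; apply/eqP/eq_bigr => i _; rewrite wQ.
  rewrite (fsum_split _ (fsubsetUl Y F0)) gerDl big_seq big1 // => e1.
  rewrite !inE => /andP[nY /orP[|e1F0]]; first by rewrite (negPf nY).
  rewrite /b; case: ifPn; rewrite ?Q0 /sqnorm ?ip0r // inE => Ee.
  suff : e1 \in Y by rewrite (negPf nY).
  by rewrite in_fset_set // inE; apply: F0F.
rewrite -rmorphB normc_def /= expr0n addr0 sqrtr_sqr ltcR.
by rewrite ler0_norm ?subr_le0 // opprB; lra.
Qed.

Lemma diagonal_nonneg : nonneg_definite ip T.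
Proof.
by have [Q [_ aQ TQ _]] := diagonal_sqrt => f; rewrite TQ aQ.
Qed.

Lemma orthonormal_basis_normalized :
  orthonormal_basis ip [set (Num.sqrt (nsq (m i)))^-1%:C%C *: m i | i in setT].
Proof.
have nm i : 0 < nsq (m i) by rewrite lt0r nsq_eq0 m_neq0 nsq_ge0.
split.
- move=> _ [i _ <-]; rewrite ip_nsq nsqZ csq_real exprVn sqr_sqrtr ?ltW //.
  by rewrite mulVf ?gt_eqF.
- move=> _ _ [i _ <-] [j _ <-] ne; rewrite ipZl ipZr orth ?mulr0 //.
  by apply: contraNneq ne => ->.
- move=> f h; apply: total => i.
  have := h _ (imageT _ i); rewrite ipZr conjC_real => /eqP.
  rewrite mulf_eq0 => /orP[|/eqP//].
  by rewrite fmorph_eq0 invr_eq0 sqrtr_eq0 leNgt nm.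
Qed.

(** T is its own absolute value, being nonnegative and self-adjoint. *)
Lemma diagonal_has_trace : has_trace ip T t%:C%C.
Proof.
split; last exact: diagonal_has_sum.
split; first exact: bounded_operatorP.
exists T; split; last first.
  exists [set (Num.sqrt (nsq (m i)))^-1%:C%C *: m i | i in setT].
    exact: orthonormal_basis_normalized.
  by exists t%:C%C; apply/diagonal_has_sum/orthonormal_basis_normalized.
split; [exact: bounded_operatorP|exact: diagonal_nonneg|].
apply/funext => f /=; rewrite (adjoint_eq (h := T (T f))) // => g.
have [Q [_ aQ TQ _]] := diagonal_sqrt.
by rewrite [T g]TQ [T (T f)]TQ !aQ.
Qed.

End Trace.

(** * Row products of a matrix of noncommuting operators *)

(** Write E i j for D j composed with Z i, so that the entries of the matrix are
    a times the Kronecker symbol minus b E i j. With anticommuting variables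
    theta_j, put delta = sum_j D j theta_j, whose square is 0 because the D j
    commute, and eta_i = a theta_i - b delta Z i. The commutation rule gives
    eta_i delta = (a + b) theta_i delta up to sign, so once a factor delta has
    been produced it passes through all the remaining rows and each of them
    contributes a + b. The lemmas below carry this out on sums over
    permutations, antisymmetry playing the role of the variables theta_j. *)
Section SymmetrizedDeterminant.
Variables (K : numFieldType) (U : lmodType K) (d : nat).
Variables (Z D : 'I_d -> {linear U -> U}) (a b : K).
Hypothesis DC : forall i j v, D i (D j v) = D j (D i v).
Hypothesis ZD : forall i j v, Z i (D j v) = D j (Z i v) + (i == j)%:R *: v.

Definition entry i j v : U := (a * (i == j)%:R) *: v - b *: D j (Z i v).

Fact entry_is_linear i j : linear (entry i j).
Proof.
move=> c u v; rewrite /entry.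
have -> : D j (Z i (c *: u + v)) = c *: D j (Z i u) + D j (Z i v) by rewrite !linearP.
by rewrite !scalerDr scalerN opprD addrACA !scalerA [c * b]mulrC [c * (a * _)]mulrC.
Qed.
HB.instance Definition _ i j :=
  GRing.isLinear.Build K U U _ (entry i j) (entry_is_linear i j).

(** The first row of the list is applied first. This is the reverse of the order
    in which dEt composes its factors, because the operators here act on
    families of vectors through the index of the family. *)
Fixpoint row_product (s : 'S_d) (r : seq 'I_d) (v : U) : U :=
  if r is k :: r' then row_product s r' (entry k (s k) v) else v.

Fact row_product_is_linear s r : linear (row_product s r).
Proof.
by move=> c; elim: r => [|k r IH] u v //=; rewrite linearP IH.
Qed.
HB.instance Definition _ s r :=
  GRing.isLinear.Build K U U _ (row_product s r) (row_product_is_linear s r).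

(** The rows outside [r] have already been used up and carry their diagonal
    entry. *)
Definition fixes_off (r : seq 'I_d) (s : 'S_d) := [forall l, (l \notin r) ==> (s l == l)].

Lemma fixes_off_cons k r s : k \notin r ->
  fixes_off r s = fixes_off (k :: r) s && (s k == k).
Proof.
move=> kr; apply/forallP/andP => [h|[/forallP h /eqP sk] l].
  split; last by have := h k; rewrite kr.
  by apply/forallP => l; apply/implyP; rewrite inE negb_or => /andP[_ lr];
     have := h l; rewrite lr.
apply/implyP => lr; have := h l; rewrite inE negb_or lr andbT.
by case: eqVneq => [->|//]; rewrite sk eqxx.
Qed.

Lemma fixes_off_nil s : fixes_off [::] s = (s == 1%g).
Proof.
apply/forallP/eqP => [h|-> l]; last by rewrite perm1 eqxx implybT.
by apply/permP => l; rewrite perm1; have /eqP := h l.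
Qed.

Lemma row_product_tperm s k l r v : k \notin r -> l \notin r ->
  row_product (tperm k l * s) r v = row_product s r v.
Proof.
elim: r v => [|j r IH] v //=; rewrite !inE !negb_or => /andP[kj kr] /andP[lj lr].
by rewrite IH // permM tpermD // eq_sym.
Qed.

Lemma fixes_off_tperm s k l r : k \in r -> l \in r ->
  fixes_off r (tperm k l * s) = fixes_off r s.
Proof.
move=> kr lr; apply: eq_forallb => j; case jr: (j \in r) => //=.
rewrite permM tpermD //.
  by apply: contraFneq jr => <-.
by apply: contraFneq jr => <-.
Qed.

(** Passing D (s k) through the row l creates three terms. The term with D (s l)
    and D (s k) is symmetric under exchange of the values of s at k and l, hence
    cancels; the diagonal term gives a, and the commutator term, after the same
    exchange, gives b. *)
Lemma row_product_derivative k r v : uniq (k :: r) ->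
  \sum_(s : 'S_d | fixes_off (k :: r) s) (-1) ^+ s *: row_product s r (D (s k) v) =
  (a + b) ^+ size r *: D k v.
Proof.
elim: r v => [|l r IH] v /=.
  move=> _; rewrite scale1r (big_pred1 (1%g : 'S_d)) => [|s].
    by rewrite odd_perm1 scale1r perm1.
  apply/idP/eqP => [h|->]; last by apply/forallP => i; rewrite perm1 eqxx implybT.
  apply/permP => i; rewrite perm1.
  have fx j : j != k -> s j = j.
    by move=> jk; move/forallP/(_ j): h; rewrite inE jk => /eqP.
  have [ik|/fx//] := eqVneq i k; rewrite ik.
  apply/eqP; apply: contraT => sk.
  by have /perm_inj := fx _ sk => /eqP; rewrite (negPf sk).
rewrite inE negb_or -!andbA => /and4P[kl kr lr ur].
have kU : uniq (k :: r) by rewrite /= kr.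
set P := fixes_off _.
have mem_k : k \in [:: k, l & r] by rewrite !inE eqxx.
have mem_l : l \in [:: k, l & r] by rewrite !inE eqxx orbT.
have PE s : fixes_off (k :: r) s = P s && (s l == l).
  rewrite (fixes_off_cons (k := l)); last by rewrite inE negb_or eq_sym kl.
  congr (_ && _); apply: eq_forallb => j; rewrite !inE; congr (~~ _ ==> _).
  by rewrite orbCA.
(* Exchanging the values of a permutation at k and l flips its sign. *)
have swap (F : 'S_d -> U) :
    \sum_(s | P s) (-1) ^+ s *: F s =
    - \sum_(s | P s) (-1) ^+ s *: F (tperm k l * s)%g.
  rewrite (reindex_inj (mulgI (tperm k l))) /= -sumrN.
  apply: eq_big => s; first by rewrite /P fixes_off_tperm.
  by move=> _; rewrite odd_mul_tperm kl signr_addb /= expr1 mulN1r scaleNr.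
have anti : \sum_(s | P s) (-1) ^+ s *: row_product s r (D (s l) (D (s k) (Z l v))) = 0.
  set x := (X in X = 0); have xN : x = - x.
    rewrite {1}/x swap; congr (- _); apply: eq_bigr => s _.
    by rewrite !permM tpermL tpermR row_product_tperm // DC.
  have /eqP : (2 : K) *: x = 0 by rewrite scaler_nat mulr2n {1}xN addNr.
  by rewrite scaler_eq0 pnatr_eq0 /= => /eqP.
have mkcond (F : 'S_d -> U) :
    \sum_(s | fixes_off (k :: r) s) (-1) ^+ s *: F s =
    \sum_(s | P s) (-1) ^+ s *: ((s l == l)%:R *: F s).
  rewrite (eq_bigl _ _ PE) big_mkcondr; apply: eq_bigr => s _.
  by case: eqP => _; rewrite ?scale1r // scale0r scaler0.
set T := \sum_(s | fixes_off (k :: r) s) (-1) ^+ s *: row_product s r (D (s k) v).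
transitivity (a *: T + b *: T).
  have -> : \sum_(s | P s) (-1) ^+ s *: row_product s r (entry l (s l) (D (s k) v)) =
      a *: (\sum_(s | P s) (-1) ^+ s *: ((s l == l)%:R *: row_product s r (D (s k) v)))
      - b *: (\sum_(s | P s) (-1) ^+ s *: row_product s r (D (s l) (D (s k) (Z l v))))
      - b *: (\sum_(s | P s) (-1) ^+ s *: ((s k == l)%:R *: row_product s r (D (s l) v))).
    rewrite !scaler_sumr -!sumrB; apply: eq_bigr => s _.
    have -> : entry l (s l) (D (s k) v) = (a * (s l == l)%:R) *: D (s k) v -
        b *: D (s l) (D (s k) (Z l v)) - (b * (s k == l)%:R) *: D (s l) v.
      rewrite /entry ZD raddfD /= scalerDr opprD addrA.
      rewrite [l == s l]eq_sym [l == s k]eq_sym; congr (_ - _).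
      by rewrite [D (s l) (_ *: _)]linearZ /= scalerA.
    rewrite !raddfB /= ![row_product s r (_ *: _)]linearZ /= !scalerA.
    by set e := (-1) ^+ s; rewrite !mulrA [e * a]mulrC [e * b]mulrC.
  rewrite anti scaler0 subr0 -scalerN [X in _ *: (- X)]swap opprK /T !mkcond.
  congr (_ + _ *: _).
  apply: eq_bigr => s _.
  by rewrite !permM tpermL tpermR row_product_tperm.
by rewrite /T IH // -scalerDl scalerA -exprS.
Qed.

Lemma row_product_cons k r v : uniq (k :: r) ->
  \sum_(s : 'S_d | fixes_off (k :: r) s) (-1) ^+ s *: row_product s (k :: r) v =
  a *: (\sum_(s : 'S_d | fixes_off r s) (-1) ^+ s *: row_product s r v) -
  (b * (a + b) ^+ size r) *: D k (Z k v).
Proof.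
move=> ur; rewrite -scalerA -row_product_derivative //.
move: ur => /= /andP[kr ur].
rewrite (eq_bigl _ _ (fun s => @fixes_off_cons k r s kr)) big_mkcondr /=.
rewrite !scaler_sumr -!sumrB; apply: eq_bigr => s _.
rewrite /entry !raddfB /= ![row_product s r (_ *: _)]linearZ /= !scalerA [k == s k]eq_sym.
set e := (-1) ^+ s; rewrite !mulrA [e * a]mulrC [e * b]mulrC.
by case: eqP => _; rewrite ?mulr1 ?scalerA // mulr0 scale0r scaler0.
Qed.

Lemma sum_row_product (i0 : 'I_d) r v : uniq r ->
  \sum_(s : 'S_d | fixes_off r s) (-1) ^+ s *: row_product s r v =
  a ^+ size r *: v -
  \sum_(i < size r) (b * (a ^+ i * (a + b) ^+ (size r - i.+1))) *:
    D (nth i0 r i) (Z (nth i0 r i) v).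
Proof.
move=> ur; elim: r ur => [|k r IH] ur.
  rewrite big_ord0 subr0 (big_pred1 (1%g : 'S_d)) => [|s].
    by rewrite odd_perm1.
  by rewrite fixes_off_nil.
rewrite row_product_cons // IH; last by case/andP: ur.
rewrite big_ord_recl /= subn1 /= mul1r scalerBr scalerA -exprS.
rewrite opprD [- _ - _]addrC addrA; congr (_ - _ - _).
rewrite scaler_sumr; apply: eq_bigr => i _.
rewrite /bump /= add1n subSS exprS scalerA; congr (_ *: _).
by ring.
Qed.

End SymmetrizedDeterminant.

(** * Taylor remainders of negative powers *)

Section BinomialRemainder.
Variable K : numFieldType.
Implicit Types (A s : K) (j n : nat).

Definition neg_binomial j n : nat := 'C((j + n).-1, n).

Lemma neg_binomialS j n :
  neg_binomial j.+1 n.+1 = (neg_binomial j n.+1 + neg_binomial j.+1 n)%N.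
Proof. by rewrite /neg_binomial !addSn addnS /= binS. Qed.

Lemma neg_binomial_gt0 j n : (0 < j)%N -> (0 < neg_binomial j n)%N.
Proof. by case: j => // j _; rewrite bin_gt0 addSn /= leq_addl. Qed.

(** [remainder j n A s] is the n-th Taylor remainder of (A - s) ^- j in s, divided
    by s ^ n: the sum of neg_binomial j (n + i) * A ^- (j + n + i) * s ^ i over
    i >= 0. The recursion comes from A (A - s) ^- j = (A - s) ^- (j - 1) +
    s (A - s) ^- j; it involves no division by s and no infinite sum, and it
    makes positivity, monotonicity and continuity at s = 0 evident. *)
Fixpoint remainder j : nat -> K -> K -> K :=
  fix aux n := fun A s =>
    match n, j with
    | 0, _ => (A - s) ^- j
    | _.+1, 0 => 0
    | n'.+1, j'.+1 => (remainder j' n A s + aux n' A s) / A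
    end.

Lemma remainder0 j A s : remainder j 0 A s = (A - s) ^- j.
Proof. by case: j. Qed.

Lemma remainder0S n A s : remainder 0 n.+1 A s = 0.
Proof. by []. Qed.

Lemma remainderSS j n A s : remainder j.+1 n.+1 A s =
  (remainder j n.+1 A s + remainder j.+1 n A s) / A.
Proof. by []. Qed.

Lemma remainder_tail j n A s : A != 0 -> A != s ->
  remainder j n A s =
  (neg_binomial j n)%:R * A ^- (j + n) + s * remainder j n.+1 A s.
Proof.
move=> A0 As; have As0 : A - s != 0 by rewrite subr_eq0.
elim: j n => [|j IHj]; first case => [|n].
- by rewrite remainder0 mulr0 addr0 mul1r addn0.
- rewrite !remainder0S mulr0 addr0 /neg_binomial bin_small ?mul0r //.
elim=> [|n IHn].
  rewrite remainderSS !remainder0 addn0 /neg_binomial bin0 mul1r.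
  have := IHj 0%N; rewrite remainder0 addn0 /neg_binomial bin0 mul1r.
  set r := remainder _ _ _ _ => e; have h : s * r = (A - s) ^- j - A ^- j.
    by rewrite e addrC addKr.
  rewrite mulrA [s * (_ + _)]mulrDr h !exprSr.
  by field; rewrite As0 A0 !expf_neq0.
rewrite remainderSS IHj IHn [in RHS]remainderSS neg_binomialS natrD.
rewrite !addSn !addnS ![A ^+ _.+1]exprSr; field.
by rewrite A0 expf_neq0.
Qed.

Lemma remainder_at0 j n A : A != 0 ->
  remainder j n A 0 = (neg_binomial j n)%:R * A ^- (j + n).
Proof. by move=> A0; rewrite remainder_tail // mul0r addr0. Qed.

Lemma remainder_le j n A s t : 0 <= s -> s <= t -> t < A ->
  remainder j n A s <= remainder j n A t.
Proof.
move=> s0 st tA; have A0 : 0 < A := le_lt_trans s0 (le_lt_trans st tA).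
have base i : remainder i 0 A s <= remainder i 0 A t.
  rewrite !remainder0 lef_pV2 ?posrE ?exprn_gt0 ?subr_gt0 ?(le_lt_trans st) //.
  by rewrite lerXn2r ?nnegrE ?subr_ge0 ?(ltW tA) ?(ltW (le_lt_trans st tA)) // lerB.
elim: j n => [|j IHj] [|n] //.
elim: n => [|n IHn]; rewrite !remainderSS ler_wpM2r ?invr_ge0 ?(ltW A0) ?lerD //.
Qed.

(** By nonnegativity of the Taylor coefficients, the remainder is at most the
    function. *)
Lemma remainder_bound j n A s : 0 <= s -> s < A ->
  s ^+ n * remainder j n A s <= (A - s) ^- j.
Proof.
move=> s0 sA; have A0 : 0 < A := le_lt_trans s0 sA.
elim: n => [|n]; first by rewrite mul1r remainder0.
apply: le_trans; rewrite [in leRHS]remainder_tail ?gt_eqF // mulrDr.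
rewrite mulrA -exprSr lerDr mulr_ge0 ?exprn_ge0 ?mulr_ge0 ?ler0n //.
by rewrite invr_ge0 exprn_ge0 ?(ltW A0).
Qed.

End BinomialRemainder.

Lemma remainder_rmorph (K L : numFieldType) (f : {rmorphism K -> L}) j n A s :
  f (remainder j n A s) = remainder j n (f A) (f s).
Proof.
have base i : f (remainder i 0 A s) = remainder i 0 (f A) (f s).
  by rewrite !remainder0 fmorphV rmorphXn rmorphB.
elim: j n => [|j IHj] [|n] //; first exact: rmorph0.
by elim: n => [|n IHn]; rewrite !remainderSS fmorph_div rmorphD IHj ?base ?IHn.
Qed.

Lemma remainder_cvg (K : numFieldType) (T : Type) (F : set_system T)
    {FF : Filter F} j n (A : K) (f : T -> K^o) :
  A != 0 -> f @ F --> (0 : K^o) ->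
  (remainder j n A (f x) : K^o) @[x --> F] -->
  ((neg_binomial j n)%:R * A ^- (j + n) : K^o).
Proof.
move=> A0 f0; rewrite -remainder_at0 //.
have base i : (remainder i 0 A (f x) : K^o) @[x --> F] --> (remainder i 0 A 0 : K^o).
  under eq_fun do rewrite remainder0.
  rewrite remainder0.
  apply: cvgV; first by rewrite subr0 expf_neq0.
  have : (A - f x : K^o) @[x --> F] --> (A - 0 : K^o).
    by apply: cvgB => //; exact: cvg_cst.
  move=> h; elim: i => [|i IH]; first exact: cvg_cst.
  by under eq_fun do rewrite exprS; rewrite exprS; exact: cvgM.
elim: j n => [|j IHj] [|n] //; first exact: cvg_cst.
elim: n => [|n IHn]; rewrite remainderSS; under eq_fun do rewrite remainderSS;
  by apply: cvgMl; apply: cvgD.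
Qed.

(** * Monomials in the Hardy space *)

Lemma near_cvg_eq (T : Type) (U : topologicalType) (F : set_system T)
    {FF : Filter F} (f g : T -> U) (l : U) :
  (\forall x \near F, f x = g x) -> f @ F --> l -> g @ F --> l.
Proof. by move=> e; apply: cvg_trans; exact: near_eq_cvg. Qed.

Lemma conjC_real_natV (R : realType) (r : R) (b m : nat) (A : R[i]) :
  (r%:C%C * (b%:R * A ^- m))^* = r%:C%C * (b%:R * (A^*) ^- m).
Proof. by rewrite rmorphM /= conjC_real rmorphM /= rmorph_nat fmorphV rmorphXn. Qed.

Section HardySpace.
Variables (R : realType) (d : nat) (H : completeNormedModType R[i]).
Local Notation C := (R[i]^o).
Local Notation V := 'rV[R[i]]_d.
Local Notation index := {ffun 'I_d -> nat}.
Variables (ip : {dot H for Num.conj}) (ev : H -> V -> R[i]^o).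
Hypothesis d_gt0 : (0 < d)%N.
Hypothesis hK : is_rkhs ip ev unit_ball hardy_kernel.
Let hip : hilbert_ip ip := rkhs_hilbert hK.
Local Notation nsq := (sqnorm ip).
Implicit Types (z w v : V) (p : V -> R[i]) (al be : index).

Definition represents h p := forall z, unit_ball z -> ev h z = p z.
Definition element p : H := xget 0 [set h | represents h p].

Lemma represents_inj h h' p : represents h p -> represents h' p -> h = h'.
Proof. by move=> hp h'p; apply: (rkhs_inj hK) => z Dz; rewrite hp ?h'p. Qed.

Lemma element_unique h p : represents h p -> element p = h.
Proof. by move=> hp; apply: xget_unique => // h' /represents_inj; apply. Qed.

Lemma element_represents h p : represents h p -> represents (element p) p.
Proof. by move=> hp; rewrite (element_unique hp). Qed.

Lemma element_ext p p' : (forall z, unit_ball z -> p z = p' z) ->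
  element p = element p'.
Proof.
move=> e; congr xget; apply/seteqP; split=> h hp z Dz; first by rewrite -e ?hp.
by rewrite e ?hp.
Qed.

Definition kern w := element (hardy_kernel ^~ w).

Lemma kern_represents w : unit_ball w -> represents (kern w) (hardy_kernel ^~ w).
Proof. by move=> /(rkhs_reproducing hK)[k [kK _]]; apply: (@element_represents k). Qed.

Lemma evE f w : unit_ball w -> ev f w = ip f (kern w).
Proof.
by move=> /(rkhs_reproducing hK)[k [kK hk]]; rewrite /kern (element_unique kK).
Qed.

Lemma cvg_ev T (F : set_system T) {FF : Filter F} (u : T -> H) (l : H) z :
  unit_ball z -> u @ F --> l -> ev (u x) z @[x --> F] --> ev l z.
Proof.
move=> Dz ul; rewrite evE //; under eq_fun do rewrite evE //.
exact: (cvg_ipl hip).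
Qed.

Definition deg al := (\sum_i al i)%N.
Definition monomial al z : R[i] := \prod_i z 0 i ^+ al i.
Definition monomial_sqnorm al : R :=
  (\prod_i (al i)`!)%:R * (d.-1)`!%:R / ((d + deg al).-1)`!%:R.

Lemma monomial_sqnorm_gt0 al : 0 < monomial_sqnorm al.
Proof.
rewrite divr_gt0 ?mulr_gt0 ?ltr0n ?fact_gt0 //.
by apply/prodn_gt0 => i; exact: fact_gt0.
Qed.

(** Up to a constant, the derivative of index al with respect to conj w of the
    reproducing kernel at w. *)
Definition szego al w z : R[i] := monomial al z * (1 - cdot z w) ^- (d + deg al).

Lemma cdotC z w : cdot z w = (cdot w z)^*.
Proof.
rewrite /cdot rmorph_sum; apply: eq_bigr => i _.
by rewrite rmorphM /= conjCK mulrC.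
Qed.

(** 2 |z_i| |w_i| is at most |z_i| ^ 2 + |w_i| ^ 2. *)
Lemma norm_cdot_lt1 z w : unit_ball z -> unit_ball w -> `|cdot z w| < 1.
Proof.
rewrite /unit_ball /= => hz hw.
have : `|cdot z w| * 2 <= \sum_(i < d) `|z 0 i| ^+ 2 + \sum_(i < d) `|w 0 i| ^+ 2.
  rewrite -big_split /= (le_trans (ler_wpM2r _ (ler_norm_sum _ _ _))) //.
  rewrite mulr_suml; apply: ler_sum => i _; rewrite normrM norm_conjC.
  rewrite -subr_ge0.
  suff -> : forall x y : R[i], x ^+ 2 + y ^+ 2 - x * y * 2 = (x - y) ^+ 2.
    by rewrite real_exprn_even_ge0 // realB ?normr_real.
  by move=> x y; ring.
move=> /le_lt_trans h; have := h _ (ltrD hz hw).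
by rewrite -[1 + 1]/(2%:R) -[X in _ < X]mul1r ltr_pM2r.
Qed.

Lemma subr_cdot_neq0 z w : unit_ball z -> unit_ball w -> 1 - cdot z w != 0.
Proof.
move=> hz hw; rewrite subr_eq0; apply: contraTneq (norm_cdot_lt1 hz hw) => <-.
by rewrite normr1 ltxx.
Qed.

Lemma unit_ball0 : unit_ball (0 : V).
Proof.
rewrite /unit_ball /= big1 ?ltr01 // => i _.
by rewrite mxE normr0 expr0n.
Qed.

Lemma cdot0 z : cdot z 0 = 0.
Proof. by rewrite /cdot big1 // => i _; rewrite mxE rmorph0 mulr0. Qed.

(** Replacing the k-th coordinate of w by x, a kernel-like function becomes a power
    series in conj x, whose coefficients are again kernel-like, for points whose
    k-th coordinate is 0. These coefficients are obtained inside H as limits. *)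
Section PeelCoordinate.
Variable k : 'I_d.

Definition add_coord w (x : R[i]) : V := \row_l (if l == k then x else w 0 l).
Definition base w := unit_ball w /\ w 0 k = 0.
Definition admissible w (x : R[i]) := x != 0 /\ unit_ball (add_coord w x).

Lemma sqnorm_add_coord w x : w 0 k = 0 ->
  \sum_(i < d) `|add_coord w x 0 i| ^+ 2 = `|x| ^+ 2 + \sum_(i < d) `|w 0 i| ^+ 2.
Proof.
move=> wk; rewrite (bigD1 k) //= [in RHS](bigD1 k) //= mxE eqxx wk normr0 expr0n.
rewrite add0r; congr (_ + _); apply: eq_bigr => i ik.
by rewrite mxE (negPf ik).
Qed.

Lemma cdot_add_coordr z w x : w 0 k = 0 ->
  cdot z (add_coord w x) = cdot z w + z 0 k * x^*.
Proof.
move=> wk; rewrite /cdot (bigD1 k) //= [in RHS](bigD1 k) //= mxE eqxx wk rmorph0 mulr0.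
rewrite add0r addrC; congr (_ + _); apply: eq_bigr => i ik.
by rewrite mxE (negPf ik).
Qed.

Lemma cdot_add_coord w w' x y : w 0 k = 0 -> w' 0 k = 0 ->
  cdot (add_coord w' y) (add_coord w x) = cdot w' w + y * x^*.
Proof.
move=> wk wk'; rewrite cdot_add_coordr // mxE eqxx; congr (_ + _).
rewrite cdotC cdot_add_coordr // wk mul0r addr0.
by rewrite -cdotC.
Qed.

Lemma admissible_near w : base w -> \forall x \near (0 : C)^', admissible w x.
Proof.
rewrite /admissible /unit_ball /= => -[wD wk].
have [e e0 eE] : exists2 e : R, 0 < e & 1 - \sum_(i < d) `|w 0 i| ^+ 2 = e%:C%C.
  by apply: gt0_complexP; rewrite subr_gt0.
have s0 : (0 : R[i]) < (Num.sqrt e)%:C%C by rewrite ltcR sqrtr_gt0.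
apply: filterS2 (@nbhs_dnbhs_neq C 0) (@dnbhs0_lt _ C _ s0) => x x0 hx.
split; first by [].
rewrite sqnorm_add_coord // -ltrBrDr eE.
have : `|x : R[i]| ^+ 2 < (Num.sqrt e)%:C%C ^+ 2.
  by rewrite ltr_pXn2r ?nnegrE ?(ltW s0).
have -> : (Num.sqrt e)%:C%C ^+ 2 = e%:C%C :> R[i].
  by rewrite -rmorphXn /= sqr_sqrtr ?(ltW e0).
by [].
Qed.

Lemma cvg_dnbhs0_mul (c : C) : (c * x : C) @[x --> (0 : C)^'] --> (0 : C).
Proof.
rewrite -[X in _ --> X](mulr0 c); apply: cvgMr.
exact: (cvg_within (fun x : C => x != 0)).
Qed.

Lemma cvg_dnbhs0_conj (c : C) : (c * x^* : C) @[x --> (0 : C)^'] --> (0 : C).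
Proof.
apply/cvgr0Pnorm_lt => e e0.
have /cvgr0Pnorm_lt/(_ _ e0) := cvg_dnbhs0_mul c.
by apply: filterS => x; rewrite !normrM norm_conjC.
Qed.

(** If the Gram matrix of a family depends continuously on y conj x alone, the
    family converges at 0: all four inner products in the squared norm of
    u x - u y tend to the same value. *)
Lemma cauchy_dnbhs0 (u : C -> H) (A : set C) (phi : C -> C) (phi0 : C) :
  (\forall x \near (0 : C)^', A x) ->
  (forall x y, A x -> A y -> ip (u x) (u y) = phi (y * x^*)) ->
  phi @ (0 : C)^' --> phi0 -> exists g : H, u @ (0 : C)^' --> g.
Proof.
move=> nA uE phi_cvg; apply: (nsq_cauchy_cvg hip) => e e0.
have e4 : (0 : C) < (e / 4)%:C%C by rewrite ltcR divr_gt0.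
have /cvgrPdist_lt/(_ _ e4) := phi_cvg.
move=> /nbhs_norm0P[r /= r0 hr].
have [q q0 qE] := gt0_complexP r0.
have m0 : (0 : C) < (Num.min 1 q)%:C%C by rewrite ltcR lt_min ltr01.
have nB := @dnbhs0_lt _ C _ m0.
exists (A `&` [set x | `|x| < (Num.min 1 q)%:C%C] `&` [set x | x != 0]).
  by apply: filterI; [exact: filterI|exact: (@nbhs_dnbhs_neq C 0)].
have small x y : x != 0 -> y != 0 ->
    `|x : C| < (Num.min 1 q)%:C%C -> `|y : C| < (Num.min 1 q)%:C%C ->
    `|phi0 - phi (y * x^*)| < (e / 4)%:C%C.
  move=> x0 y0 hx hy; apply: hr => /=; last by rewrite mulf_neq0 ?conjC_eq0.
  rewrite normrM norm_conjC qE.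
  have hq : (Num.min 1 q)%:C%C <= q%:C%C :> R[i] by rewrite lecR ge_min lexx orbT.
  have h1 : (Num.min 1 q)%:C%C <= 1 :> R[i].
    by rewrite -(rmorph1 (real_complex R)) lecR ge_min lexx.
  apply: (@le_lt_trans _ _ (`|y| * 1)).
    by rewrite ler_wpM2l // (le_trans (ltW hx)).
  by rewrite mulr1 (lt_le_trans hy).
move=> x y [[Ax hx] x0] [[Ay hy] y0].
have E : (nsq (u x - u y))%:C%C =
    phi (x * x^*) - phi (y * x^*) - (phi (x * y^*) - phi (y * y^*)).
  by rewrite -ip_nsq ipBl !ipBr !uE.
have h1 := small _ _ x0 x0 hx hx; have h2 := small _ _ x0 y0 hx hy.
have h3 := small _ _ y0 x0 hy hx; have h4 := small _ _ y0 y0 hy hy.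
have : `|phi (x * x^*) - phi (y * x^*) - (phi (x * y^*) - phi (y * y^*))| < e%:C%C.
  have -> : phi (x * x^*) - phi (y * x^*) - (phi (x * y^*) - phi (y * y^*)) =
     (phi0 - phi (y * x^*)) + (phi0 - phi (x * y^*)) -
     ((phi0 - phi (x * x^*)) + (phi0 - phi (y * y^*))) by ring.
  have -> : e%:C%C = (e / 4)%:C%C + (e / 4)%:C%C + ((e / 4)%:C%C + (e / 4)%:C%C) :> R[i].
    by rewrite -!rmorphD; congr (_%:C%C); field.
  apply: le_lt_trans (ler_normB _ _) _; apply: ltrD.
    by apply: le_lt_trans (ler_normD _ _) _; apply: ltrD.
  by apply: le_lt_trans (ler_normD _ _) _; apply: ltrD.
by rewrite -E ger0_norm ?ltcR // lecR nsq_ge0.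
Qed.

Section Peel.
Variables (al : index) (Base : V -> Prop).
Local Notation j := (d + deg al)%N.
Local Notation nu := (monomial_sqnorm al)%:C%C.
Hypothesis Base_base : forall w, Base w -> base w.
Hypothesis szego_represented : forall w x, Base w -> unit_ball (add_coord w x) ->
  exists h, represents h (szego al (add_coord w x)).
Hypothesis szego_ip : forall w w' x y, Base w -> Base w' ->
  unit_ball (add_coord w x) -> unit_ball (add_coord w' y) ->
  ip (element (szego al (add_coord w x))) (element (szego al (add_coord w' y))) =
  nu * (1 - cdot (add_coord w' y) (add_coord w x)) ^- j.

(** As a function of conj x, the function [szego al (add_coord w x)] has n-th Taylor
    coefficient [coef_fun n w], and [tail_fun n w x] is what remains of it beyond
    order n, divided by (conj x) ^ n. *)
Definition tail_fun n w x z : R[i] :=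
  monomial al z * z 0 k ^+ n * remainder j n (1 - cdot z w) (z 0 k * x^*).
Definition coef_fun n w z : R[i] :=
  monomial al z * z 0 k ^+ n * ((neg_binomial j n)%:R * (1 - cdot z w) ^- (j + n)).
Local Notation U n w x := (element (tail_fun n w x)).
Local Notation G n w := (element (coef_fun n w)).

Let ball_base w : Base w -> unit_ball w. Proof. by case/Base_base. Qed.
Let base0 w : Base w -> w 0 k = 0. Proof. by case/Base_base. Qed.

Lemma tail_fun0 w x z : w 0 k = 0 -> tail_fun 0 w x z = szego al (add_coord w x) z.
Proof.
move=> wk; rewrite /tail_fun /szego expr0 mulr1 remainder0 (cdot_add_coordr _ _ wk).
by rewrite opprD addrA.
Qed.

Lemma subr_add_coord_neq w x z : Base w -> unit_ball (add_coord w x) ->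
  unit_ball z -> 1 - cdot z w != z 0 k * x^*.
Proof.
move=> /base0 wk hx /subr_cdot_neq0/(_ hx); rewrite cdot_add_coordr //.
by rewrite opprD addrA subr_eq0.
Qed.

Lemma tail_funS n w x z : Base w -> admissible w x -> unit_ball z ->
  tail_fun n.+1 w x z = (x^*)^-1 * (tail_fun n w x z - coef_fun n w z).
Proof.
move=> hw [x0 hx] hz; rewrite /tail_fun /coef_fun [remainder _ n _ _]remainder_tail.
- have xc : x^* != 0 by rewrite conjC_eq0.
  rewrite exprSr; set r := remainder _ _ _ _; set b := (neg_binomial _ _)%:R * _.
  by move: (monomial al z) (z 0 k) (z 0 k ^+ n) r b => ? ? ? ? ?; field.
- exact/subr_cdot_neq0/ball_base.
- exact: subr_add_coord_neq.
Qed.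

(** The tails are in H, and their Gram matrix is the corresponding Taylor tail of
    the Gram matrix of the kernels; this passes from n to n + 1 because the limit
    at x = 0 of the n-th tail is the n-th coefficient. *)
Definition tail_ok n :=
  (forall w x, Base w -> admissible w x -> represents (U n w x) (tail_fun n w x)) /\
  (forall w w' x y, Base w -> Base w' -> admissible w x -> admissible w' y ->
     ip (U n w x) (U n w' y) = nu * remainder j n (1 - cdot w' w) (y * x^*)).

Lemma tail_cvg n w : tail_ok n -> Base w ->
  represents (G n w) (coef_fun n w) /\ U n w x @[x --> (0 : C)^'] --> G n w.
Proof.
move=> [hU ipU] hw.
have Aw := admissible_near (Base_base hw).
have A0 z : unit_ball z -> 1 - cdot z w != 0.
  by move=> hz; apply: subr_cdot_neq0 (ball_base hw).
have [g hg] : exists g : H, U n w x @[x --> (0 : C)^'] --> g.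
  have hphi : (nu * remainder j n (1 - cdot w w) s : C) @[s --> (0 : C)^'] -->
      (nu * ((neg_binomial j n)%:R * (1 - cdot w w) ^- (j + n)) : C).
    apply: cvgMr; apply: remainder_cvg; first exact/A0/ball_base.
    exact: (cvg_within (fun x : C => x != 0)).
  apply: (cauchy_dnbhs0 Aw _ hphi) => x y hx hy.
  by rewrite ipU.
have gE : represents g (coef_fun n w).
  move=> z hz; apply: (@cvgC_unique _ _ (0 : C)^' _ (fun x => ev (U n w x) z)).
    exact: cvg_ev.
  have : (tail_fun n w x z : C) @[x --> (0 : C)^'] --> (coef_fun n w z : C).
    apply: cvgMr; apply: remainder_cvg; first exact: A0.
    exact: cvg_dnbhs0_conj.
  apply: near_cvg_eq; apply: filterS Aw => x hx.
  by rewrite hU.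
by rewrite (element_unique gE).
Qed.

Lemma ip_tail_coef n w w' x : tail_ok n -> Base w -> Base w' -> admissible w x ->
  ip (U n w x) (G n w') = nu * ((neg_binomial j n)%:R * (1 - cdot w' w) ^- (j + n)).
Proof.
move=> ok hw hw' hx; have [_ ipU] := ok; have [_ hG] := tail_cvg ok hw'.
have h : (ip (U n w x) (U n w' y) : C) @[y --> (0 : C)^'] --> (ip (U n w x) (G n w') : C).
  by apply: (cvg_ipr hip); exact: hG.
apply: (cvgC_unique h).
have : (nu * remainder j n (1 - cdot w' w) (y * x^*) : C) @[y --> (0 : C)^'] -->
    (nu * ((neg_binomial j n)%:R * (1 - cdot w' w) ^- (j + n)) : C).
  apply: cvgMr; apply: remainder_cvg.
    by apply: subr_cdot_neq0; exact: ball_base.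
  by under eq_fun do rewrite mulrC; exact: cvg_dnbhs0_mul.
apply: near_cvg_eq.
apply: filterS (admissible_near (Base_base hw')) => y hy.
by rewrite ipU.
Qed.

Lemma ip_coef_coef n w w' : tail_ok n -> Base w -> Base w' ->
  ip (G n w) (G n w') = nu * ((neg_binomial j n)%:R * (1 - cdot w' w) ^- (j + n)).
Proof.
move=> ok hw hw'; have [_ hG] := tail_cvg ok hw.
have h : (ip (U n w x) (G n w') : C) @[x --> (0 : C)^'] --> (ip (G n w) (G n w') : C).
  by apply: (cvg_ipl hip); exact: hG.
apply: (cvgC_unique h); apply: cvg_near_cst.
apply: filterS (admissible_near (Base_base hw)) => x hx.
exact: ip_tail_coef.
Qed.

Lemma tail_step n w x : tail_ok n -> Base w -> admissible w x ->
  represents ((x^*)^-1 *: (U n w x - G n w)) (tail_fun n.+1 w x).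
Proof.
move=> ok hw hx z hz; have [hG _] := tail_cvg ok hw; have [hU _] := ok.
rewrite tail_funS // evE // ipZl ipBl -!evE // hU //.
by rewrite hG.
Qed.

Lemma tail_ok_all n : tail_ok n.
Proof.
elim: n => [|n IH].
  have e w x : Base w -> U 0 w x = element (szego al (add_coord w x)).
    by move=> /base0 wk; apply: element_ext => z _; exact: tail_fun0.
  split=> [w x hw [x0 hx] z hz|w w' x y hw hw' [x0 hx] [y0 hy]].
    have [h /element_represents hh] := szego_represented hw hx.
    by rewrite e // hh // tail_fun0 // base0.
  rewrite (e _ _ hw) (e _ _ hw') (szego_ip hw hw' hx hy) remainder0.
  rewrite (cdot_add_coord _ _ (base0 hw) (base0 hw')).
  by rewrite opprD addrA.
have UE w x : Base w -> admissible w x -> U n.+1 w x = (x^*)^-1 *: (U n w x - G n w).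
  by move=> hw hx; apply: element_unique; exact: tail_step.
split=> [w x hw hx|w w' x y hw hw' hx hy].
  by rewrite UE //; exact: tail_step.
have x0 : x^* != 0 by rewrite conjC_eq0; case: hx.
have y0 : y != 0 by case: hy.
have hA : 1 - cdot w' w != 0 by apply: subr_cdot_neq0; exact: ball_base.
have [_ ipU] := IH.
rewrite !UE // ipZl ipZr fmorphV /= conjCK ipBl !ipBr.
rewrite [ip (G n w) (U n w' y)]ipC !ip_tail_coef // ip_coef_coef // ipU //.
rewrite conjC_real_natV rmorphB rmorph1 /= -cdotC.
rewrite remainder_tail //; last first.
  have [_ hx'] := hx; have [_ hy'] := hy.
  have := subr_cdot_neq0 hy' hx'; rewrite cdot_add_coord ?base0 //.
  by rewrite opprD addrA subr_eq0.
set r := remainder _ _ _ _; set b := (neg_binomial _ _)%:R * _.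
by move: (x^*) x0 @r => x' x0 r; field; rewrite x0 y0.
Qed.

Lemma coef_represented n w : Base w -> represents (G n w) (coef_fun n w).
Proof. by move=> hw; have [] := tail_cvg (tail_ok_all n) hw. Qed.

Lemma tail_orth_coef m n w w' x : (m < n)%N -> Base w -> Base w' -> admissible w x ->
  ip (U n w x) (G m w') = 0.
Proof.
move=> + hw hw'; elim: n x => [//|n IH] x mn hx.
rewrite (element_unique (tail_step (tail_ok_all n) hw hx)) ipZl ipBl.
move: mn; rewrite ltnS leq_eqVlt => /predU1P[->|mn].
  rewrite ip_tail_coef ?ip_coef_coef ?subrr ?mulr0 //; exact: tail_ok_all.
rewrite IH // sub0r; suff -> : ip (G n w) (G m w') = 0 by rewrite oppr0 mulr0.
have [_ hG] := tail_cvg (tail_ok_all n) hw.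
have h : (ip (U n w x) (G m w') : C) @[x --> (0 : C)^'] --> (ip (G n w) (G m w') : C).
  by apply: (cvg_ipl hip); exact: hG.
apply: (cvgC_unique h); apply: cvg_near_cst.
apply: filterS (admissible_near (Base_base hw)) => y hy.
exact: IH.
Qed.

Lemma coef_orth m n w w' : m != n -> Base w -> Base w' -> ip (G n w) (G m w') = 0.
Proof.
suff lt (a b : nat) v v' : (a < b)%N -> Base v -> Base v' -> ip (G b v) (G a v') = 0.
  rewrite neq_ltn => /orP[mn|nm] hw hw'; first exact: lt.
  by rewrite ipC lt // rmorph0.
move=> ab hv hv'; have [_ hG] := tail_cvg (tail_ok_all b) hv.
have h : (ip (U b v x) (G a v') : C) @[x --> (0 : C)^'] --> (ip (G b v) (G a v') : C).
  by apply: (cvg_ipl hip); exact: hG.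
apply: (cvgC_unique h); apply: cvg_near_cst.
apply: filterS (admissible_near (Base_base hv)) => y hy.
exact: tail_orth_coef.
Qed.

(** A vector orthogonal to a family of functions is orthogonal to its Taylor
    coefficients. *)
Lemma szego_orth_coef h :
  (forall w x, Base w -> unit_ball (add_coord w x) ->
     ip (element (szego al (add_coord w x))) h = 0) ->
  forall n w, Base w -> ip (G n w) h = 0.
Proof.
move=> hh.
have lim n : (forall w x, Base w -> admissible w x -> ip (U n w x) h = 0) ->
    forall w, Base w -> ip (G n w) h = 0.
  move=> hU w hw; have [_ hG] := tail_cvg (tail_ok_all n) hw.
  have hl : (ip (U n w x) h : C) @[x --> (0 : C)^'] --> (ip (G n w) h : C).
    by apply: (cvg_ipl hip); exact: hG.
  apply: (cvgC_unique hl); apply: cvg_near_cst.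
  apply: filterS (admissible_near (Base_base hw)) => x hx.
  exact: hU.
suff hU n w x : Base w -> admissible w x -> ip (U n w x) h = 0.
  by move=> n; apply: lim => w x; exact: hU.
elim: n w x => [|n IH] w x hw hx.
  rewrite (element_ext (p' := szego al (add_coord w x))); last first.
    by move=> z _; apply: tail_fun0; exact: base0.
  by apply: hh => //; case: hx.
rewrite (element_unique (tail_step (tail_ok_all n) hw hx)) ipZl ipBl IH //.
by rewrite lim // subrr mulr0.
Qed.

Lemma geometric_le0 (x q M : R) : 0 <= q -> q < 1 ->
  (forall n, x <= q ^+ n * M) -> x <= 0.
Proof.
move=> q0 q1 h; have : (fun n => q ^+ n * M) @ \oo --> 0 * M.
  by apply: cvgMl; apply: cvg_expr; rewrite ger0_norm.
rewrite mul0r => /cvgr_to_ge; apply; exact: filterE.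
Qed.

(** If f is orthogonal to all coefficients, its inner product with the function
    is that with (conj x) ^ n times the n-th tail, for every n. The bound on the
    remainder at some t between |x| ^ 2 and 1 - <w, w> makes this decay like
    (|x| ^ 2 / t) ^ n. *)
Lemma coef_total f w x : Base w -> unit_ball (add_coord w x) ->
  (forall n, ip (G n w) f = 0) -> ip (element (szego al (add_coord w x))) f = 0.
Proof.
move=> hw hx hG; have wk := base0 hw.
rewrite (element_ext (p' := tail_fun 0 w x)); last first.
  by move=> z _; rewrite tail_fun0.
have [x0|x0] := eqVneq x 0.
  rewrite -(hG 0%N); congr (ip _ f); apply: element_ext => z hz.
  rewrite /tail_fun /coef_fun x0 rmorph0 mulr0 remainder_at0 //.
  exact: subr_cdot_neq0 (ball_base hw).
have ax : admissible w x by [].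
have iterU n : ip (U 0 w x) f = (x^*) ^+ n * ip (U n w x) f.
  elim: n => [|n ->]; first by rewrite mul1r.
  rewrite (element_unique (tail_step (tail_ok_all n) hw ax)) ipZl ipBl hG subr0.
  by rewrite exprSr mulrA -[_ * _ * (_)^-1]mulrA mulfV ?mulr1 // conjC_eq0.
have [A AE] : exists A : R, 1 - cdot w w = A%:C%C.
  have : 1 - cdot w w \is Num.real.
    apply: realB; first exact: real1.
    by apply: sum_real => i _; rewrite -normCK realX ?normr_real.
  by move=> /complex_realP[A ->]; exists A.
have xA : csq x < A.
  rewrite -ltcR -AE ltrBrDl csqE -normCK.
  move: hx; rewrite /unit_ball /= sqnorm_add_coord // addrC.
  rewrite /cdot; under eq_bigr do rewrite normCK.
  by [].
have x2 : x * x^* = (csq x)%:C%C by rewrite csqE.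
have s0 : 0 < csq x by rewrite lt0r csq_eq0 x0 csq_ge0.
pose t := (csq x + A) / 2.
have st : csq x < t by rewrite /t; lra.
have tA : t < A by rewrite /t; lra.
have t0 : 0 < t by exact: lt_trans st.
have nE n : nsq (U n w x) = monomial_sqnorm al * remainder j n A (csq x).
  apply: complexI; have [_ ipU] := tail_ok_all n.
  by rewrite -ip_nsq ipU // x2 AE -(remainder_rmorph (real_complex R)) -rmorphM.
apply/eqP; rewrite -csq_eq0 eq_le csq_ge0 andbT.
apply: (@geometric_le0 _ (csq x / t)
    (monomial_sqnorm al * (A - t) ^- j * nsq f)).
- by rewrite divr_ge0 ?ltW.
- by rewrite ltr_pdivrMr ?mul1r.
move=> n; rewrite (iterU n) csqM.
have -> : csq (x^* ^+ n) = csq x ^+ n.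
  by apply: complexI; rewrite rmorphXn /= !csqE rmorphXn /= conjCK exprMn mulrC.
apply: (le_trans (ler_wpM2l _ (CauchySchwarz_nsq _ _ _))).
  by rewrite exprn_ge0 ?csq_ge0.
have swap (a b c e : R) : a * (b * c * e) = b * (a * c) * e by ring.
rewrite nE !swap ler_wpM2r ?nsq_ge0 // ler_wpM2l ?(ltW (monomial_sqnorm_gt0 _)) //.
rewrite expr_div_n -mulrA ler_wpM2l ?exprn_ge0 ?(ltW s0) //.
rewrite mulrC ler_pdivlMr ?exprn_gt0 // mulrC.
apply: le_trans (remainder_bound j n (ltW t0) tA).
by rewrite ler_wpM2l ?exprn_ge0 ?(ltW t0) // remainder_le // ltW.
Qed.

End Peel.
End PeelCoordinate.

(** At stage k the first k coordinates have been expanded: exponents live on them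
    and points vanish on them. Stage 0 consists of the reproducing kernels, stage
    d of the monomials. *)
Definition stage_index (k : nat) al := forall l : 'I_d, (k <= l)%N -> al l = 0%N.
Definition stage_ball (k : nat) w :=
  unit_ball w /\ forall l : 'I_d, (l < k)%N -> w 0 l = 0.

Record stage (k : nat) : Prop := Stage {
  stage_represents : forall al w, stage_index k al -> stage_ball k w ->
    represents (element (szego al w)) (szego al w);
  stage_ip : forall al w w', stage_index k al -> stage_ball k w -> stage_ball k w' ->
    ip (element (szego al w)) (element (szego al w')) =
    (monomial_sqnorm al)%:C%C * (1 - cdot w' w) ^- (d + deg al);
  stage_orth : forall al be w w', stage_index k al -> stage_index k be ->
    stage_ball k w -> stage_ball k w' -> al != be ->
    ip (element (szego al w)) (element (szego be w')) = 0;
  stage_total : forall f, (forall al w, stage_index k al -> stage_ball k w ->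
    ip (element (szego al w)) f = 0) -> f = 0 }.

Lemma stage0 : stage 0.
Proof.
have al0 al : stage_index 0 al -> forall l, al l = 0%N by move=> h l; exact: h.
have deg0 al : stage_index 0 al -> deg al = 0%N.
  by move=> /al0 h; rewrite /deg big1.
have E al w z : stage_index 0 al -> szego al w z = hardy_kernel z w.
  move=> h; rewrite /szego /monomial /hardy_kernel deg0 // addn0 big1 ?mul1r //.
  by move=> i _; rewrite al0.
have eE al w : stage_index 0 al -> element (szego al w) = kern w.
  by move=> h; apply: element_ext => z _; exact: E.
split.
- move=> al w hal [hw _] z hz; rewrite eE // E //.
  exact: (kern_represents hw hz).
- move=> al w w' hal [hw _] [hw' _]; rewrite !eE // -evE //.
  rewrite (kern_represents hw hw') /hardy_kernel deg0 // addn0.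
  rewrite /monomial_sqnorm deg0 // addn0 big1 => [|i _]; last by rewrite al0.
  by rewrite mul1r divff ?mul1r // pnatr_eq0 -lt0n fact_gt0.
- move=> al be w w' /al0 hal /al0 hbe _ _ /eqP[].
  by apply/ffunP => l; rewrite hal hbe.
- move=> f h; apply: (rkhs_inj hK) => w hw; rewrite !evE // ip0l.
  have := h [ffun=> 0%N] w; rewrite eE; last by move=> l _; rewrite ffunE.
  by move=> h0; rewrite ipC h0 ?rmorph0 // => l _; rewrite ffunE.
Qed.

Definition clear_exp (k : 'I_d) al : index := [ffun l => if l == k then 0%N else al l].
Definition set_exp (k : 'I_d) n al : index := [ffun l => if l == k then n else al l].

Lemma deg_clear k al : deg al = (deg (clear_exp k al) + al k)%N.
Proof.
rewrite /deg (bigD1 k) //= [in RHS](bigD1 k) //= ffunE eqxx add0n addnC; congr (_ + _)%N.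
by apply: eq_bigr => l lk; rewrite ffunE (negPf lk).
Qed.

Lemma monomial_clear k al z : monomial al z = monomial (clear_exp k al) z * z 0 k ^+ al k.
Proof.
rewrite /monomial (bigD1 k) //= [in RHS](bigD1 k) //= ffunE eqxx mul1r mulrC.
congr (_ * _).
by apply: eq_bigr => l lk; rewrite ffunE (negPf lk).
Qed.

Lemma monomial_sqnorm_clear k al :
  monomial_sqnorm al =
  monomial_sqnorm (clear_exp k al) / (neg_binomial (d + deg (clear_exp k al)) (al k))%:R.
Proof.
rewrite /monomial_sqnorm (deg_clear k al) addnA.
set j := (d + deg (clear_exp k al))%N; set n := al k.
have j0 : (0 < j)%N by rewrite /j addn_gt0 d_gt0.
have -> : (\prod_i (al i)`! = \prod_i (clear_exp k al i)`! * n`!)%N.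
  rewrite (bigD1 k) //= [in RHS](bigD1 k) //= ffunE eqxx fact0 mul1n mulnC.
  congr (_ * _)%N.
  by apply: eq_bigr => l lk; rewrite ffunE (negPf lk).
have e : (neg_binomial j n * (n`! * (j.-1)`!) = ((j + n).-1)`!)%N.
  rewrite /neg_binomial -(@bin_fact (j + n).-1 n); last first.
    by case: (j) j0 => // ? _; rewrite addSn /= leq_addl.
  by congr (_ * (_ * _`!))%N; case: (j) j0 => // ? _; rewrite addSn /= addnK.
rewrite -e !natrM.
have n0 m : (m`!)%:R != 0 :> R by rewrite pnatr_eq0 -lt0n fact_gt0.
have b0 : (neg_binomial j n)%:R != 0 :> R by rewrite pnatr_eq0 -lt0n neg_binomial_gt0.
by field; rewrite !n0 b0.
Qed.

(** The functions of stage k + 1 are, up to the scalar c, the Taylor coefficients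
    in the k-th coordinate of those of stage k. *)
Lemma stageS (k : 'I_d) : stage k -> stage k.+1.
Proof.
move=> st.
pose Base := stage_ball k.+1.
have Base_base w : Base w -> base k w by move=> [hw h0]; split=> //; exact: h0.
have addB w x : Base w -> unit_ball (add_coord k w x) -> stage_ball k (add_coord k w x).
  move=> [_ h0] hx; split=> // l lk; rewrite mxE ifN ?h0 ?ltnS 1?ltnW //.
  by apply: contraTneq lk => ->; rewrite ltnn.
have clearP be : stage_index k.+1 be -> stage_index k (clear_exp k be).
  move=> h l kl; rewrite ffunE; case: eqP => // /eqP lk; apply: h.
  by rewrite ltn_neqAle kl andbT eq_sym.
have repr al : stage_index k al -> forall w x, Base w -> unit_ball (add_coord k w x) ->
    exists h, represents h (szego al (add_coord k w x)).
  move=> hal w x hw hx; exists (element (szego al (add_coord k w x))).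
  by apply: (stage_represents st) => //; exact: addB.
have ips al : stage_index k al -> forall w w' x y, Base w -> Base w' ->
    unit_ball (add_coord k w x) -> unit_ball (add_coord k w' y) ->
    ip (element (szego al (add_coord k w x))) (element (szego al (add_coord k w' y))) =
    (monomial_sqnorm al)%:C%C *
    (1 - cdot (add_coord k w' y) (add_coord k w x)) ^- (d + deg al).
  by move=> hal w w' x y hw hw' hx hy; apply: (stage_ip st) => //; exact: addB.
pose c be : R[i] := (neg_binomial (d + deg (clear_exp k be)) (be k))%:R.
have c0 be : c be != 0.
  by rewrite pnatr_eq0 -lt0n neg_binomial_gt0 // addn_gt0 d_gt0.
pose G be w := element (coef_fun k (clear_exp k be) (be k) w).
have GP be w : stage_index k.+1 be -> Base w ->
    represents (G be w) (coef_fun k (clear_exp k be) (be k) w).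
  move=> /clearP hbe hw.
  exact: (coef_represented Base_base (repr _ hbe) (ips _ hbe)).
have szE be w z : szego be w z = (c be)^-1 * coef_fun k (clear_exp k be) (be k) w z.
  rewrite /szego /coef_fun (monomial_clear k) (deg_clear k be) addnA -/(c be).
  by rewrite [RHS]mulrCA; congr (_ * _); rewrite mulrA mulVf ?mul1r.
have szP be w : stage_index k.+1 be -> Base w ->
    represents ((c be)^-1 *: G be w) (szego be w).
  by move=> hbe hw z hz; rewrite evE // ipZl -evE // szE GP.
have eE be w : stage_index k.+1 be -> Base w ->
    element (szego be w) = (c be)^-1 *: G be w.
  by move=> hbe hw; apply: element_unique; exact: szP.
split.
- by move=> be w hbe hw; rewrite eE //; exact: szP.
- move=> be w w' hbe hw hw'; rewrite !eE // ipZl ipZr fmorphV rmorph_nat.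
  have hc := clearP _ hbe.
  rewrite (ip_coef_coef Base_base (tail_ok_all Base_base (repr _ hc) (ips _ hc) _)) //.
  rewrite (monomial_sqnorm_clear k be) (deg_clear k be) addnA.
  rewrite (rmorphM (real_complex R) (monomial_sqnorm (clear_exp k be))).
  rewrite fmorphV rmorph_nat.
  rewrite -/(c be); set A := _ ^- _.
  by move: (c be) (c0 be) => c1 c10; field.
- move=> be be' w w' hbe hbe' hw hw' ne; rewrite !eE // ipZl ipZr.
  suff -> : ip (G be w) (G be' w') = 0 by rewrite !mulr0.
  have hc := clearP _ hbe; have hc' := clearP _ hbe'.
  have [ec|ec] := eqVneq (clear_exp k be) (clear_exp k be').
    rewrite /G -ec; apply: (coef_orth Base_base (repr _ hc) (ips _ hc)) => //.
    apply: contraNneq ne => en; apply/eqP/ffunP => l.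
    have [->//|lk] := eqVneq l k.
    by have /ffunP/(_ l) := ec; rewrite !ffunE (negPf lk).
  apply: (szego_orth_coef Base_base (repr _ hc) (ips _ hc)) => // v x hv hx.
  rewrite ipC.
  rewrite (szego_orth_coef Base_base (repr _ hc') (ips _ hc')) ?rmorph0 // => v' y hv' hy.
  by apply: (stage_orth st) => //; [exact: addB|exact: addB|rewrite eq_sym].
- move=> f hf; apply: (stage_total st) => al v hal [hv hv0].
  pose w := add_coord k v 0.
  have hw : Base w.
    split=> [|l]; last first.
      rewrite ltnS mxE; case: (eqVneq l k) => // lk.
      by rewrite leq_eqVlt val_eqE (negPf lk); exact: hv0.
    rewrite /unit_ball /=; apply: le_lt_trans hv; apply: ler_sum => l _.
    by rewrite mxE; case: eqP => // _; rewrite normr0 expr0n exprn_ge0.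
  have vE : v = add_coord k w (v 0 k).
    by apply/rowP => l; rewrite !mxE; case: eqP => // ->.
  rewrite vE; apply: (coef_total Base_base (repr _ hal) (ips _ hal)) => //.
    by rewrite -vE.
  move=> n; pose be := set_exp k n al.
  have hbe : stage_index k.+1 be.
    by move=> l kl; rewrite ffunE ifN ?hal ?(ltnW kl) // -val_eqE gtn_eqF.
  have ce : clear_exp k be = al.
    apply/ffunP => l; rewrite !ffunE; case: eqP => // ->; by rewrite hal.
  have bk : be k = n by rewrite ffunE eqxx.
  have := hf _ _ hbe hw; rewrite eE // ipZl => /eqP.
  by rewrite mulf_eq0 invr_eq0 (negPf (c0 be)) /G ce bk => /eqP.
Qed.

Lemma stage_all : stage d.
Proof.
suff h k : (k <= d)%N -> stage k by exact: h.
elim: k => [|k IH] kd; first exact: stage0.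
exact: (@stageS (Ordinal kd)) (IH (ltnW kd)).
Qed.

Definition mono al := element (monomial al).

Lemma szego_at0 al z : szego al 0 z = monomial al z.
Proof. by rewrite /szego cdot0 subr0 expr1n invr1 mulr1. Qed.

Let mono_szego al : mono al = element (szego al 0).
Proof. by apply: element_ext => z _; rewrite szego_at0. Qed.

Let index_all al : stage_index d al.
Proof. by move=> l; rewrite leqNgt ltn_ord. Qed.

Let ball_all : stage_ball d 0.
Proof. by split=> [|l _]; [exact: unit_ball0|rewrite mxE]. Qed.

Lemma mono_represents al : represents (mono al) (monomial al).
Proof.
move=> z hz; rewrite mono_szego (stage_represents stage_all) //.
exact: szego_at0.
Qed.

Lemma mono_nsq al : nsq (mono al) = monomial_sqnorm al.
Proof.
apply: complexI; rewrite -ip_nsq mono_szego (stage_ip stage_all) // cdot0 subr0.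
by rewrite expr1n invr1 mulr1.
Qed.

Lemma mono_orth al be : al != be -> ip (mono al) (mono be) = 0.
Proof. by move=> ne; rewrite !mono_szego (stage_orth stage_all). Qed.

Lemma mono_total f : (forall al, ip f (mono al) = 0) -> f = 0.
Proof.
move=> h; apply: (stage_total stage_all) => al w _ [_ hw].
have -> : w = 0 by apply/rowP => l; rewrite mxE hw.
by rewrite -mono_szego ipC h rmorph0.
Qed.

Lemma mono_neq0 al : mono al != 0.
Proof. by rewrite -(nsq_eq0 ip) mono_nsq gt_eqF ?monomial_sqnorm_gt0. Qed.

End HardySpace.

(** * The operators dEt on monomials *)

Section Shifts.
Variable d : nat.
Local Notation index := {ffun 'I_d -> nat}.
Implicit Types (al be : index) (i j : 'I_d).

Definition up i al : index := [ffun l => (al l + (l == i))%N].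
Definition down i al : index := [ffun l => (al l - (l == i))%N].

Lemma upK i : cancel (up i) (down i).
Proof. by move=> al; apply/ffunP => l; rewrite !ffunE addnK. Qed.

Lemma downK i al : (0 < al i)%N -> up i (down i al) = al.
Proof.
move=> ai; apply/ffunP => l; rewrite !ffunE.
by case: eqP => [->|_]; rewrite ?subnK // subn0 addn0.
Qed.

Lemma down_up i j al : i != j -> down j (up i al) = up i (down j al).
Proof.
move=> ij; apply/ffunP => l; rewrite !ffunE; case: (eqVneq l i) => [->|_].
  by rewrite (negPf ij) !subn0.
by rewrite !addn0.
Qed.

Lemma down_down i j al : down i (down j al) = down j (down i al).
Proof. by apply/ffunP => l; rewrite !ffunE -!subnDA addnC. Qed.

Lemma deg_up i al : deg (up i al) = (deg al).+1.
Proof.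
rewrite /deg; under eq_bigr do rewrite ffunE; rewrite big_split /=.
rewrite [X in (_ + X)%N](bigD1 i) //= eqxx [X in (_ + (_ + X))%N]big1 => [|l /negPf ->//].
by rewrite addn0 addn1.
Qed.

Lemma deg_down i al : (0 < al i)%N -> deg al = (deg (down i al)).+1.
Proof. by move=> /downK {1}<-; rewrite deg_up. Qed.

Lemma leq_deg i al : (al i <= deg al)%N.
Proof. by rewrite /deg (bigD1 i) //= leq_addr. Qed.

(** On the family of monomials, [shift_up i] is multiplication by z_i and
    [shift_down j] is differentiation in z_j. They act on an arbitrary family
    through its index, and so commute with linear maps applied to its values. *)
Section Operators.
Variables (K : numFieldType) (E : lmodType K).
Local Notation W := (index -> E).

Definition shift_up i (phi : W) : W := fun al => phi (up i al).
Definition shift_down j (phi : W) : W := fun al => (al j)%:R *: phi (down j al).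

Fact shift_up_is_linear i : linear (shift_up i).
Proof. by []. Qed.
HB.instance Definition _ i :=
  GRing.isLinear.Build K W W _ (shift_up i) (shift_up_is_linear i).

Fact shift_down_is_linear i : linear (shift_down i).
Proof.
move=> c u v; apply/funext => al.
transitivity (c *: shift_down i u al + shift_down i v al); last by [].
by rewrite /shift_down [(c *: u + v) _]/(_ + _) scalerDr !scalerA mulrC.
Qed.
HB.instance Definition _ i :=
  GRing.isLinear.Build K W W _ (shift_down i) (shift_down_is_linear i).

Lemma shift_downC i j phi :
  shift_down i (shift_down j phi) = shift_down j (shift_down i phi).
Proof.
apply/funext => al; rewrite /shift_down !scalerA down_down.
have [->//|ij] := eqVneq i j.
by rewrite !ffunE (negPf ij) eq_sym (negPf ij) !subn0 mulrC.
Qed.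

Lemma shift_up_down i j phi :
  shift_up i (shift_down j phi) = shift_down j (shift_up i phi) + (i == j)%:R *: phi.
Proof.
apply/funext => al; rewrite /shift_up /shift_down /= !fctE ffunE eq_sym.
have [->|ij] := eqVneq i j; last by rewrite addn0 scale0r addr0 down_up.
rewrite upK scale1r addn1 -natr1 scalerDl scale1r; congr (_ + _).
by have [->|a0] := posnP (al j); [rewrite !scale0r|rewrite downK].
Qed.

Section RowProduct.
Variables (a b : K).
Local Notation B := (entry shift_up shift_down a b).
Local Notation P := (row_product shift_up shift_down a b).

Lemma entryE i j phi al : B i j phi al =
  (a * (i == j)%:R) *: phi al - (b * (al j)%:R) *: phi (up i (down j al)).
Proof. by rewrite -[(b * _) *: _]scalerA. Qed.

Lemma row_product_map s r phi (X : E -> E) al : linear X ->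
  X (P s r phi al) = P s r (fun be => X (phi be)) al.
Proof.
move=> lX; elim: r phi => [|k r IH] phi //=; rewrite IH.
congr (row_product _ _ _ _ _ _ _ _).
have X0 : X 0 = 0 by have := lX (-1) 0 0; rewrite !scaleN1r oppr0 addr0 addNr.
have XZ q u : X (q *: u) = q *: X u by have := lX q u 0; rewrite X0 !addr0.
by apply/funext => be; rewrite !entryE lX -scaleNr XZ scaleNr.
Qed.

(** Entries preserve the degree; hence the coefficients a and b, which depend on
    the degree in the application, can be treated as constants. *)
Lemma row_product_local s r phi psi al :
  (forall be, deg be = deg al -> phi be = psi be) -> P s r phi al = P s r psi al.
Proof.
elim: r phi psi => [|k r IH] phi psi h /=; first exact: h.
apply: IH => be hbe; rewrite !entryE h //.
have [->|b0] := posnP (be (s k)); first by rewrite mulr0 !scale0r.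
by rewrite (h (up _ _)) // deg_up -deg_down.
Qed.

(** The outermost operator of the composition commutes with the row product formed
    by the others and reaches the family first: hence the reversal of the order. *)
Lemma bigcomp_row_product (A : 'I_d -> 'I_d -> E -> E) (phi : W) (s : 'S_d) r al :
  (forall i j, linear (A i j)) ->
  (forall i j be, deg be = deg al -> A i j (phi be) = B i j phi be) ->
  (\big[comp/idfun]_(l <- r) A l (s l)) (phi al) = P s r phi al.
Proof.
move=> lA hA; elim: r => [|k r IH]; first by rewrite big_nil.
rewrite big_cons /= IH (row_product_map _ _ _ _ (lA k (s k))).
by apply: row_product_local => be hbe; exact: hA.
Qed.

End RowProduct.
End Operators.
End Shifts.

(** The sum does not depend on p, so it is the average over p of the double sum. *)
Lemma sum_perm_eval (K : numFieldType) (d : nat) (x : 'I_d -> K) (p : 'I_d) :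
  \sum_(t : 'S_d) x (t p) = (d.-1)`!%:R * \sum_i x i.
Proof.
have indep q : \sum_(t : 'S_d) x (t q) = \sum_(t : 'S_d) x (t p).
  rewrite (reindex_inj (mulgI (tperm p q))) /=; apply: eq_bigr => t _.
  by rewrite permM tpermR.
have dpos : (0 < d)%N := leq_ltn_trans (leq0n p) (ltn_ord p).
have d0 : d%:R != 0 :> K by rewrite pnatr_eq0 -lt0n.
apply: (mulfI d0); rewrite mulrA -natrM.
have -> : (d * (d.-1)`!)%N = d`! by case: (d) dpos => // d' _; rewrite factS.
have -> : d%:R * \sum_(t : 'S_d) x (t p) = \sum_(q < d) \sum_(t : 'S_d) x (t q).
  by rewrite (eq_bigr _ (fun q _ => indep q)) sumr_const card_ord mulr_natl.
rewrite exchange_big /=.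
have -> : \sum_(t : 'S_d) \sum_(q < d) x (t q) = \sum_(t : 'S_d) \sum_i x i.
  by apply: eq_bigr => t _; rewrite [RHS](reindex_inj (@perm_inj _ t)).
by rewrite sumr_const card_Sn mulr_natl.
Qed.

(** The scalar by which dEt acts in degree n when its entries are
    a times the Kronecker symbol minus b times z_i d/dz_j. *)
Definition dEt_coef (K : numFieldType) (d n : nat) (a b : K) : K :=
  (d.-1)`!%:R * (d%:R * a ^+ d - n%:R * ((a + b) ^+ d - a ^+ d)).

Section Symmetrize.
Variables (d : nat) (K : numFieldType) (E : lmodType K) (a b : K).
Local Notation index := {ffun 'I_d -> nat}.
Local Notation P := (row_product (@shift_up d K E) (@shift_down d K E) a b).

(** For a fixed ordering t of the rows, the (t i)-th exponent enters with the weight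
    b a ^ i (a + b) ^ (d - i - 1). Summing over t replaces each exponent by
    (d - 1)! times the degree, and the weights add up to (a + b) ^ d - a ^ d. *)
Lemma symmetrized_row_products (phi : index -> E) al : (0 < d)%N ->
  \sum_(t : 'S_d) \sum_(s : 'S_d)
    (-1) ^+ s *: P s (map t (enum 'I_d)) phi al =
  dEt_coef d (deg al) a b *: phi al.
Proof.
move=> d0; pose i0 := Ordinal d0.
have row (t : 'S_d) : \sum_(s : 'S_d)
    (-1) ^+ s *: P s (map t (enum 'I_d)) phi al =
  (a ^+ d - \sum_(i < d) b * (a ^+ i * (a + b) ^+ (d - i.+1)) *
     (al (t i))%:R) *: phi al.
  have ut : uniq (map t (enum 'I_d)).
    by rewrite map_inj_uniq ?enum_uniq //; exact: perm_inj.
  have all_t l : l \in map t (enum 'I_d).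
    by apply/mapP; exists (t^-1%g l); rewrite ?mem_enum // permKV.
  have -> : \sum_(s : 'S_d) (-1) ^+ s *: P s (map t (enum 'I_d)) phi al =
      (\sum_(s : 'S_d | fixes_off (map t (enum 'I_d)) s)
         (-1) ^+ s *: P s (map t (enum 'I_d)) phi) al.
    rewrite fct_sumE; apply: eq_bigl => s; symmetry.
    by apply/forallP => l; rewrite all_t.
  rewrite (sum_row_product _ _ (@shift_downC _ _ _) (@shift_up_down _ _ _) i0) //.
  rewrite size_map size_enum_ord scalerBl; congr (_ - _).
  rewrite fct_sumE scaler_suml; apply: eq_bigr => i _.
  rewrite (nth_map i0) ?size_enum_ord // nth_ord_enum.
  transitivity ((b * (a ^+ i * (a + b) ^+ (d - i.+1))) *:
    ((al (t i))%:R *: phi (up (t i) (down (t i) al)))); first by [].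
  rewrite scalerA.
  by have [->|x0] := posnP (al (t i)); [rewrite mulr0 !scale0r|rewrite downK].
rewrite (eq_bigr _ (fun t _ => row t)) -scaler_suml; congr (_ *: _).
rewrite sumrB sumr_const card_Sn exchange_big /=.
under eq_bigr => i _.
  rewrite -mulr_sumr (sum_perm_eval (fun l => (al l)%:R)) -natr_sum.
  over.
rewrite -mulr_suml -mulr_sumr /dEt_coef subrXX [a + b - a]addrAC subrr add0r.
have -> : d`! = ((d.-1)`! * d)%N by rewrite -[in LHS](prednK d0) factS prednK // mulnC.
under [in RHS]eq_bigr => i _.
  rewrite mulrC -subn1 -subnDA add1n.
  over.
rewrite -/(deg al) -[_ *+ _]mulr_natl natrM.
by set S := \sum_(i < d) _; ring.
Qed.

End Symmetrize.

(** * The eigenvalues of dEt and their sum *)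

Definition eigenvalue (K : numFieldType) (d n : nat) : K :=
  (d.-1)`!%:R * ((n + d)%:R * (n + d)%:R ^- d - n%:R * (n + d.-1)%:R ^- d).

(** Here a + b = (n + d - 1) ^ -1, except in degree 0 for d = 1, where a + b is
    multiplied by n = 0. *)
Lemma dEt_coef_eigenvalue (K : numFieldType) d n : (0 < d)%N ->
  dEt_coef d n ((n + d)%:R^-1) ((n + d)%:R^-1 * (n + d.-1)%:R^-1) =
  eigenvalue K d n.
Proof.
move=> d0; rewrite /dEt_coef /eigenvalue; congr (_ * _).
have [->|n0] := posnP n; first by rewrite !mul0r !subr0 add0n exprVn.
have -> : (n + d)%:R^-1 + (n + d)%:R^-1 * (n + d.-1)%:R^-1 = (n + d.-1)%:R^-1 :> K.
  have h1 : (n + d.-1)%:R != 0 :> K by rewrite pnatr_eq0 -lt0n addn_gt0 n0.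
  have h2 : (n + d)%:R != 0 :> K by rewrite pnatr_eq0 -lt0n addn_gt0 n0.
  have e : (n + d)%:R = (n + d.-1)%:R + 1 :> K.
    by rewrite -[in LHS](prednK d0) addnS natr1.
  rewrite e in h2 *; move: (_%:R) h1 h2 => q h1 h2.
  by field; rewrite h1 h2.
by rewrite !exprVn natrD; ring.
Qed.

Section EigenvalueSums.
Variables (R : realType) (d : nat).
Hypothesis d_gt0 : (0 < d)%N.
Local Notation eig n := (eigenvalue R d n).
Local Notation index := {ffun 'I_d -> nat}.

(** Bernoulli's inequality for 1 - 1 / x, with denominators cleared. *)
Lemma bernoulli_pow (x : R) m : m.+1%:R <= x ->
  (x - m.+1%:R) * x ^+ m <= (x - 1) ^+ m.+1.
Proof.
elim: m => [|m IH] mx; first by rewrite mulr1.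
have mx' : m.+1%:R <= x by apply: le_trans mx; rewrite ler_nat.
have m0 : 0 <= m.+1%:R :> R by [].
have x1 : 1 <= x by apply: le_trans mx'; rewrite ler1n.
rewrite [leRHS]exprS; apply: le_trans (ler_wpM2l _ (IH mx')); last by rewrite subr_ge0.
rewrite [leRHS]mulrA exprS mulrA ler_wpM2r ?exprn_ge0 ?(le_trans ler01) //.
rewrite -natr1; nra.
Qed.

Lemma eigenvalue_ge0 n : 0 <= eig n.
Proof.
rewrite mulr_ge0 ?ler0n // subr_ge0.
have [->|n0] := posnP n; first by rewrite mul0r mulr_ge0 // invr_ge0 exprn_ge0.
have p0 : 0 < (n + d)%:R :> R by rewrite ltr0n addn_gt0 n0.
have p1 : 0 < (n + d.-1)%:R :> R by rewrite ltr0n addn_gt0 n0.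
rewrite ler_pdivrMr ?exprn_gt0 // mulrAC ler_pdivlMr ?exprn_gt0 //.
have := @bernoulli_pow (n + d)%:R d.-1; rewrite prednK // => /(_ _).
rewrite ler_nat leq_addl => /(_ isT).
have -> : (n + d)%:R - d%:R = n%:R :> R by rewrite natrD addrK.
have -> : (n + d)%:R - 1 = (n + d.-1)%:R :> R.
  by rewrite -[in LHS](prednK d_gt0) addnS -natr1 addrK.
move=> h; have -> : (n + d)%:R ^+ d = (n + d)%:R * (n + d)%:R ^+ d.-1 :> R.
  by rewrite -exprS prednK.
by rewrite mulrCA ler_wpM2l // ltW.
Qed.

(** The sum of the eigenvalues over the monomials of degree less than n: see
    [sum_corner]. *)
Definition partial_trace n : R := ((n + d.-1) ^_ d)%:R / (n + d.-1)%:R ^+ d.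

(** The sum telescopes: 'C(n + d - 1, d - 1) (d - 1)! is (n + 1) ... (n + d - 1),
    which times n + d, or n, is the numerator of the next, or the present,
    partial trace. *)
Lemma partial_traceS n :
  partial_trace n + 'C(d.-1 + n, d.-1)%:R * eig n = partial_trace n.+1.
Proof.
rewrite /partial_trace /eigenvalue mulrA -natrM bin_ffact.
rewrite -[in X in (_ ^_ X)%:R / _ + _](prednK d_gt0) ffactnSr addnK.
rewrite [(d.-1 + n)%N]addnC mulrBr.
have -> : ((n.+1 + d.-1) ^_ d = (n + d) * (n + d.-1) ^_ d.-1)%N.
  by rewrite -[in LHS](prednK d_gt0) /= addSn ffactSS -addnS prednK.
have -> : (n.+1 + d.-1 = n + d)%N by rewrite addSn -addnS prednK.
by rewrite !natrM; ring.
Qed.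

Lemma partial_trace0 : partial_trace 0 = 0.
Proof. by rewrite /partial_trace add0n ffact_small ?mul0r // prednK. Qed.

Lemma ffact_le_exp n m : (n ^_ m <= n ^ m)%N.
Proof.
elim: m => [|m IH]; first by rewrite ffactn0.
by rewrite ffactnSr expnSr leq_mul // leq_subr.
Qed.

Lemma exp_le_ffact n m p : (m <= p.+1)%N -> (n ^ m <= (n + p) ^_ m)%N.
Proof.
elim: m => [|m IH] mp; first by rewrite ffactn0.
rewrite ffactnSr expnSr leq_mul ?IH ?(ltnW mp) //.
by rewrite -addnBA ?leq_addr.
Qed.

Lemma partial_trace_le1 n : partial_trace n <= 1.
Proof.
rewrite /partial_trace; have [e|p0] := posnP (n + d.-1).
  rewrite e expr0n gtn_eqF // invr0 mulr0; exact: ler01.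
by rewrite ler_pdivrMr ?exprn_gt0 ?ltr0n // mul1r -natrX ler_nat ffact_le_exp.
Qed.

Lemma one_sub_pow (x : R) m : 0 <= x -> x <= 1 -> 1 - m%:R * x <= (1 - x) ^+ m.
Proof.
move=> x0 x1; elim: m => [|m IH]; first by rewrite mul0r subr0.
rewrite exprS; apply: le_trans (ler_wpM2l _ IH); last by rewrite subr_ge0.
by have : 0 <= m%:R :> R by []; rewrite -natr1; nra.
Qed.

(** A partial trace is at least (n / (n + d - 1)) ^ d, and Bernoulli's inequality
    applies to n / (n + d - 1) = 1 - x. *)
Lemma partial_trace_gt (e : R) : 0 < e -> exists n, 1 - e < partial_trace n.
Proof.
move=> e0; pose M : R := d%:R * (d.-1)%:R / e.
have M0 : 0 <= M by rewrite /M divr_ge0 ?mulr_ge0 // ltW.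
exists (Num.bound M); set n := Num.bound M.
have Mn : M < n%:R by exact: archi_boundP.
have n0 : 0 < n%:R :> R by exact: le_lt_trans Mn.
have q0 : 0 < (n + d.-1)%:R :> R by rewrite natrD ltr_wpDr.
pose x : R := (d.-1)%:R / (n + d.-1)%:R.
have xe : n%:R / (n + d.-1)%:R = 1 - x.
  apply: (mulIf (negbT (gt_eqF q0))).
  by rewrite /x mulrBl !divfK ?gt_eqF // mul1r natrD addrK.
have x0 : 0 <= x by rewrite divr_ge0.
have x1 : x <= 1 by rewrite -subr_ge0 -xe divr_ge0.
have dx : d%:R * x < e.
  rewrite /x mulrA ltr_pdivrMr // [e * _]mulrC -ltr_pdivrMr //; apply: (lt_le_trans Mn).
  by rewrite ler_nat leq_addr.
apply: lt_le_trans (_ : (1 - x) ^+ d <= _).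
  by apply: lt_le_trans (one_sub_pow d x0 x1); rewrite ltrD2l ltrN2.
rewrite -xe expr_div_n /partial_trace ler_wpM2r ?invr_ge0 ?exprn_ge0 //.
by rewrite -natrX ler_nat exp_le_ffact // prednK.
Qed.

(** Exponents of degree n come from tuples, which are counted as ordered partitions
    of n. *)
Definition level n : seq index :=
  [seq [ffun i : 'I_d => val (tnth t i)] |
     t : d.-tuple 'I_n.+1 in
     finset (fun t : d.-tuple 'I_n.+1 => \sum_(i <- t) i == n)%N].

Lemma mem_level n (al : index) : (al \in level n) = (deg al == n).
Proof.
rewrite /level; apply/fintype.imageP/eqP => [[t]|<-].
  rewrite inE => /eqP tn ->; apply: etrans tn; rewrite /deg big_tuple.
  by apply: eq_bigr => i _; rewrite ffunE.
have al_lt i : (al i < (deg al).+1)%N by rewrite ltnS leq_deg.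
exists [tuple Ordinal (al_lt i) | i < d].
  by rewrite inE big_tuple; apply/eqP; apply: eq_bigr => i _; rewrite tnth_mktuple.
by apply/ffunP => i; rewrite ffunE tnth_mktuple.
Qed.

Lemma level_uniq n : uniq (level n).
Proof.
rewrite map_inj_uniq ?enum_uniq // => t t' e; apply: eq_from_tnth => i.
by apply: val_inj; have /ffunP/(_ i) := e; rewrite !ffunE.
Qed.

Lemma size_level n : size (level n) = 'C(d.-1 + n, d.-1).
Proof.
by rewrite size_image; have := card_ord_partitions d.-1 n; rewrite (prednK d_gt0).
Qed.

Fixpoint corner n : {fset index} :=
  if n is n'.+1 then (corner n' `|` [fset al in level n'])%fset else fset0.

Lemma mem_corner n (al : index) : (al \in corner n) = (deg al < n)%N.
Proof.
elim: n => [|n IH] //=.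
by rewrite !inE /= IH mem_level ltnS [RHS]leq_eqVlt orbC.
Qed.

Lemma sum_corner n : \sum_(al <- corner n) eig (deg al) = partial_trace n.
Proof.
elim: n => [|n IH]; first by rewrite /= big_seq_fset0 partial_trace0.
rewrite -partial_traceS -IH (@fsum_split _ _ _ (corner n)); last exact: fsubsetUl.
congr (_ + _).
have -> : \sum_(al <- (corner n.+1 `\` corner n)%fset) eig (deg al) =
    \sum_(al <- level n) eig (deg al).
  apply: perm_big; apply: uniq_perm; rewrite ?fset_uniq ?level_uniq // => al.
  by rewrite in_fsetD !mem_corner mem_level -leqNgt ltnS eqn_leq andbC.
rewrite big_seq (eq_bigr (fun=> eig n)) => [|al]; last by rewrite mem_level => /eqP ->.
by rewrite -big_seq big_const_seq count_predT size_level iter_addr_0 mulr_natl.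
Qed.

Lemma sum_eigenvalue_le1 (X : {fset index}) : \sum_(al <- X) eig (deg al) <= 1.
Proof.
pose N := (\max_(al <- X) deg al).+1.
have XN : (X `<=` corner N)%fset.
  by apply/fsubsetP => al alX; rewrite mem_corner ltnS; exact: leq_bigmax_seq.
apply: le_trans (partial_trace_le1 N); rewrite -sum_corner (fsum_split _ XN) lerDl.
by apply: sumr_ge0 => al _; exact: eigenvalue_ge0.
Qed.

Lemma sum_eigenvalue_gt e : 0 < e ->
  exists X : {fset index}, 1 - e < \sum_(al <- X) eig (deg al).
Proof.
by move=> /partial_trace_gt[n hn]; exists (corner n); rewrite sum_corner.
Qed.

End EigenvalueSums.

(** * The coordinate multipliers and the theorem *)

Section CoordinateOperators.
Variables (R : realType) (d : nat) (H : completeNormedModType R[i]).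
Local Notation C := (R[i]^o).
Local Notation V := 'rV[R[i]]_d.
Local Notation index := {ffun 'I_d -> nat}.
Variables (ip : {dot H for Num.conj}) (ev : H -> V -> R[i]^o).
Hypothesis d_gt0 : (0 < d)%N.
Hypothesis hK : is_rkhs ip ev unit_ball hardy_kernel.
Let hip : hilbert_ip ip := rkhs_hilbert hK.
Local Notation nsq := (sqnorm ip).
Local Notation mono := (mono ev).
Local Notation S := (coordinate_mult ev).
Implicit Types (al be : index) (i j : 'I_d).

Lemma monomial_up i al (z : V) : monomial (up i al) z = z 0 i * monomial al z.
Proof.
rewrite /monomial; under eq_bigr do rewrite ffunE exprD.
rewrite big_split /= mulrC; congr (_ * _).
by rewrite (bigD1 i) //= eqxx big1 ?mulr1 // => l /negPf ->.
Qed.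

Lemma sqnorm_up i al :
  monomial_sqnorm R (up i al) =
  (al i).+1%:R / (d + deg al)%:R * monomial_sqnorm R al.
Proof.
rewrite /monomial_sqnorm deg_up addnS /=.
have -> : (\prod_l (up i al l)`! = (al i).+1 * \prod_l (al l)`!)%N.
  rewrite (bigD1 i) //= [in RHS](bigD1 i) //= ffunE eqxx addn1 factS -mulnA.
  by do 2!congr (_ * _)%N; apply: eq_bigr => l /negPf li; rewrite ffunE li addn0.
have -> : ((d + deg al)`! = (d + deg al) * ((d + deg al).-1)`!)%N.
  by rewrite -{1 2}(@prednK (d + deg al)) ?factS ?prednK // addn_gt0 d_gt0.
rewrite !natrM.
have n0 : (d + deg al)%:R != 0 :> R by rewrite pnatr_eq0 -lt0n addn_gt0 d_gt0.
have f0 m : (m`!)%:R != 0 :> R by rewrite pnatr_eq0 -lt0n fact_gt0.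
by move: (_%:R) n0 => q n0; field; rewrite n0 !f0.
Qed.

Let orth := mono_orth d_gt0 hK.
Let total := mono_total d_gt0 hK.

(** The weighted shift that raises the i-th exponent has the values of z_i f,
    because this holds on monomials and evaluation is a continuous form. *)
Lemma coordinate_mult_bounded i :
  bounded ip (S i) /\ forall al, S i (mono al) = mono (up i al).
Proof.
have [||al|T [bT TE]] := @weighted_shift _ _ _ hip _ _ orth (fun=> 1) (up i) 1.
- exact: ler01.
- by move=> al be _ _ /(can_inj (upK i)).
- rewrite !(mono_nsq d_gt0 hK) csq_real expr1n sqnorm_up !mul1r.
  rewrite ler_piMl ?(ltW (monomial_sqnorm_gt0 _ _)) //.
  rewrite ler_pdivrMr ?ltr0n ?addn_gt0 ?d_gt0 // mul1r ler_nat.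
  by rewrite -add1n leq_add ?leq_deg.
suff -> : S i = T by split=> // al; rewrite TE scale1r.
apply/funext => f.
have TP z : unit_ball z -> ev (T f) z = z 0 i * ev f z.
  move=> hz; rewrite !(evE hK) //.
  have := bounded_form_eq hip orth total bT (boundedZ (z 0 i) (bounded_id ip))
    (g := kern ev z) (g' := kern ev z).
  rewrite /= => -> => [|al]; first by rewrite ipZl.
  rewrite TE scale1r ipZl -!(evE hK) // !(mono_represents d_gt0 hK) //.
  exact: monomial_up.
apply: xget_unique => // h hh; apply: (rkhs_inj hK) => z hz.
by rewrite hh // TP.
Qed.

Lemma adjoint_coordinate_mult j :
  bounded ip (adjoint ip (S j)) /\ forall al,
  adjoint ip (S j) (mono al) =
  ((al j)%:R / (deg al + d.-1)%:R : R)%:C%C *: mono (down j al).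
Proof.
pose a al : R := (al j)%:R / (deg al + d.-1)%:R.
have a_neq0 al : (a al)%:C%C != 0 :> R[i] -> (0 < al j)%N.
  by rewrite fmorph_eq0 lt0n; apply: contraNneq => e; rewrite /a e mul0r.
have a_up al : a (up j al) = (al j).+1%:R / (d + deg al)%:R.
  rewrite /a deg_up ffunE eqxx addn1; congr (_ / _%:R).
  by rewrite addSn -addnS prednK // addnC.
have [|al be a1 b1 e|al|T [bT TE]] := @weighted_shift _ _ _ hip _ _ orth
  (fun al => (a al)%:C%C) (down j) 1.
- exact: ler01.
- by rewrite -(downK (a_neq0 _ a1)) e downK // a_neq0.
- rewrite !(mono_nsq d_gt0 hK) csq_real mul1r.
  have [al0|al0] := posnP (al j).
    by rewrite /a al0 !mul0r expr0n mul0r ltW ?monomial_sqnorm_gt0.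
  rewrite -{3}(downK al0) sqnorm_up -a_up downK // expr2 -mulrA.
  rewrite ler_piMl ?mulr_ge0 ?(ltW (monomial_sqnorm_gt0 _ _)) ?divr_ge0 //.
  rewrite ler_pdivrMr ?mul1r ?ler_nat ?(leq_trans (leq_deg j al)) ?leq_addr //.
  by rewrite ltr0n addn_gt0 (leq_trans al0) ?leq_deg.
have [bS SE] := coordinate_mult_bounded j.
have adj : forall f g, ip (S j f) g = ip f (T g).
  apply: (bounded_adjoint hip orth total bS bT) => al be.
  rewrite SE TE ipZr conjC_real.
  have [e|ne] := eqVneq be (up j al).
    rewrite e upK !ip_nsq !(mono_nsq d_gt0 hK) sqnorm_up a_up.
    by rewrite (rmorphM (real_complex R)).
  rewrite orth 1?eq_sym //.
  have [b0|b0] := posnP (be j); first by rewrite /a b0 mul0r rmorph0 mul0r.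
  rewrite orth ?mulr0 //; apply: contraNneq ne => ->.
  by rewrite downK.
suff -> : adjoint ip (S j) = T by split.
by apply/funext => g; apply: adjoint_eq => f; exact: adj.
Qed.

Lemma commutator_bounded i j : bounded ip (commutator_block ip S i j).
Proof.
have [bS _] := coordinate_mult_bounded i.
have [bA _] := adjoint_coordinate_mult j.
exact: boundedB (bounded_comp bA bS) (bounded_comp bS bA).
Qed.

(** With z_i d/dz_j acting on degree n, the commutator of S_j^* and S_i is
    1 / (n + d) times the Kronecker symbol plus
    1 / (n + d) - 1 / (n + d - 1) times z_i d/dz_j. *)
Lemma commutator_mono n i j al : deg al = n ->
  commutator_block ip S i j (mono al) =
  entry (@shift_up d _ H) (@shift_down d _ H)
    ((n + d)%:R^-1) ((n + d)%:R^-1 * (n + d.-1)%:R^-1) i j mono al.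
Proof.
move=> dn; rewrite entryE /commutator_block.
have [_ SE] := coordinate_mult_bounded i.
have [_ AE] := adjoint_coordinate_mult j.
have [lS _] := (coordinate_mult_bounded i).1.
have SZ c f : S i (c *: f) = c *: S i f.
  have := lS c f 0.
  by rewrite (linear_at0 (coordinate_mult_bounded i).1) !addr0.
rewrite SE !AE SZ SE deg_up dn !(fmorph_div (real_complex R)) !rmorph_nat /=.
have -> : (n.+1 + d.-1 = n + d)%N by rewrite addSn -addnS prednK.
rewrite ffunE eq_sym.
have nd0 : (n + d)%:R != 0 :> R[i] by rewrite pnatr_eq0 -lt0n addn_gt0 d_gt0 orbT.
have [a0|a0] := posnP (al j).
  rewrite a0 mul0r mulr0 !scale0r !subr0 add0n mulrC.
  by have [->|_] := eqVneq i j; [rewrite upK|rewrite mulr0n !mulr0 !scale0r].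
have nd1 : (n + d.-1)%:R != 0 :> R[i].
  by rewrite pnatr_eq0 -lt0n -dn addn_gt0 (leq_trans a0) ?leq_deg.
have e : (n + d)%:R = (n + d.-1)%:R + 1 :> R[i].
  by rewrite -[in LHS](prednK d_gt0) addnS natr1.
have [ij|ij] := eqVneq i j.
  rewrite -ij in a0 *; rewrite upK downK // -[LHS]scalerBl -[RHS]scalerBl.
  rewrite mulr1 addn1 -natr1; congr (_ *: _).
  rewrite e in nd0 *; move: ((n + d.-1)%:R) ((al i)%:R) nd0 nd1 => q x nd0 nd1.
  by field; rewrite nd0 nd1.
rewrite down_up // addn0 mulr0 scale0r sub0r -scalerBl -[RHS]scaleNr; congr (_ *: _).
rewrite e in nd0 *; move: ((n + d.-1)%:R) ((al j)%:R) nd0 nd1 => q x nd0 nd1.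
by field; rewrite nd0 nd1.
Qed.

Lemma dEt_mono al : dEt (commutator_block ip S) (mono al) =
  (eigenvalue R d (deg al))%:C%C *: mono al.
Proof.
have bB := commutator_bounded.
pose a : R[i] := (deg al + d)%:R^-1.
pose b : R[i] := (deg al + d)%:R^-1 * (deg al + d.-1)%:R^-1.
rewrite /dEt exchange_big /=.
have -> : (eigenvalue R d (deg al))%:C%C = dEt_coef d (deg al) a b :> R[i].
  rewrite dEt_coef_eigenvalue // /eigenvalue.
  by rewrite !(rmorphM, rmorphB, fmorphV, rmorphXn, rmorph_nat).
rewrite -symmetrized_row_products //.
apply: eq_bigr => t _; apply: eq_bigr => s _; congr (_ *: _).
rewrite -(@bigcomp_row_product _ _ _ a b (commutator_block ip S)).
- by rewrite big_map enumT [index_enum _]unlock.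
- by move=> i j; case: (bB i j).
- by move=> i j be hbe; exact: commutator_mono.
Qed.

Lemma dEt_bounded : bounded ip (dEt (commutator_block ip S)).
Proof.
apply: bounded_bigsum => s; apply: bounded_bigsum => t; apply: boundedZ.
by apply: bounded_bigcomp => i; exact: commutator_bounded.
Qed.

End CoordinateOperators.

Theorem theorem5p1 (R : realType) (d : nat) (H : completeNormedModType R[i])
  (ip : {dot H for Num.conj}) (ev : H -> 'rV[R[i]]_d -> R[i]^o) :
  (0 < d)%N -> is_hardy_space ip ev ->
  let S := coordinate_mult ev in
  nonneg_definite ip (dEt (commutator_block ip S)) /\
  has_trace ip (dEt (commutator_block ip S)) 1.
Proof.
move=> d_gt0 [hK _] S; have hip := rkhs_hilbert hK.
have orth := mono_orth d_gt0 hK; have total := mono_total d_gt0 hK.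
have bT := dEt_bounded d_gt0 hK; have TE := dEt_mono d_gt0 hK.
have c0 (al : {ffun 'I_d -> nat}) : 0 <= eigenvalue R d (deg al) by exact: eigenvalue_ge0.
have c_le := sum_eigenvalue_le1 R d_gt0.
split; first exact: (diagonal_nonneg hip orth total c0 bT TE c_le).
rewrite -(rmorph1 (real_complex R)).
apply: (diagonal_has_trace hip orth total (mono_neq0 d_gt0 hK) c0 bT TE c_le).
exact: sum_eigenvalue_gt.
Qed.
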